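(* Fix $p\in(1,2]$, $r>0$ and positive integers $m,n$. The set $\mathbb{B}_{S(p)}(r)=\{X\in\mathbb{R}^{m\times n} : \|X\|_{S(p)}\le r\}$ is $\frac{p-1}{r}$-strongly convex with respect to the norm $\|\cdot\|_{S(p)}$ and $\frac{(p-1)\min(m,n)^{\frac12-\frac1p}}{r}$-strongly convex with respect to the Frobenius norm $\|\cdot\|_F$.
   Context: For $X\in\mathbb{R}^{m\times n}$, $\sigma(X)$ denotes the vector of its $\min(m,n)$ singular values in descending order, and the Schatten $\ell_p$ norm is $\|X\|_{S(p)}=\|\sigma(X)\|_p=\left(\sum_{i=1}^{\min(m,n)}\sigma(X)_i^p\right)^{1/p}$. A convex set $\mathcal{K}$ in a finite-dimensional real vector space $E$ is $\alpha$-strongly convex with respect to a norm $\|\cdot\|$ on $E$ if for any $x,y\in\mathcal{K}$, any $\gamma\in[0,1]$ and any $z\in E$ with $\|z\|=1$, it holds that $\gamma x+(1-\gamma)y+\gamma(1-\gamma)\frac{\alpha}{2}\|x-y\|^2 z\in\mathcal{K}$. *)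

(* Defs.v *)
From HB Require Import structures.
From mathcomp Require Import all_boot all_order all_algebra.
From mathcomp Require Import polyrcf.
From mathcomp Require Import boolp classical_sets reals exp convex.

Set Implicit Arguments.
Unset Strict Implicit.
Unset Printing Implicit Defensive.

Import Order.TTheory GRing.Theory Num.Theory.

Local Open Scope classical_set_scope.
Local Open Scope ring_scope.

(* The real eigenvalues of A, each repeated according to its algebraic
   multiplicity. *)
Definition eigenvalues (R : realType) (n : nat) (A : 'M[R]_n) : seq R :=
  flatten [seq nseq (mup x (char_poly A)) x | x <- rootsR (char_poly A)].

(* X^T X has n real eigenvalues, at most min(m, n) of which are nonzero: the
   entries that the truncation to min(m, n) coordinates drops are all zero. *)
Definition singular_values (R : realType) (m n : nat) (X : 'M[R]_(m, n)) :
    'rV[R]_(minn m n) :=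
  \row_(i < minn m n)
    (sort >=%R [seq Num.sqrt x | x <- eigenvalues (X^T *m X)])`_i.

Definition lp_norm (R : realType) (p : R) (k : nat) (v : 'rV[R]_k) : R :=
  (\sum_(i < k) `|v 0 i| `^ p) `^ p^-1.

Definition schatten_norm (R : realType) (p : R) (m n : nat)
    (X : 'M[R]_(m, n)) : R :=
  lp_norm p (singular_values X).

Definition frobenius_norm (R : realType) (m n : nat) (X : 'M[R]_(m, n)) : R :=
  Num.sqrt (\sum_(i < m) \sum_(j < n) X i j ^+ 2).

Definition schatten_ball (R : realType) (p : R) (m n : nat) (r : R) :
    set 'M[R]_(m, n) :=
  [set X | schatten_norm p X <= r].

(* N is meant to be a norm on E. *)
Definition strongly_convex (R : realType) (E : vectType R) (N : E -> R)
    (alpha : R) (K : set E) : Prop :=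
  convex_set K /\
  forall (x y : E) (gamma : R) (z : E),
    K x -> K y -> 0 <= gamma <= 1 -> N z = 1 ->
    K (gamma *: x + (1 - gamma) *: y
       + (gamma * (1 - gamma) * (alpha / 2) * N (x - y) ^+ 2) *: z).

(* Main.v *)
(* Everything rests on a lower bound for the Bregman divergence of the trace
   function Tr |A|^p: if A and B are symmetric with p-norms at most r, then
     Tr |B|^p - Tr |A|^p - <d(Tr |.|^p)(A), B - A>
       >= p (p - 1) / 2 * r^(p - 2) * ||B - A||_p^2.
   In eigenbases u_i of A and v_j of B the left-hand side is exactly
   sum_ij <u_i, v_j>^2 D(a_i, b_j), with D the scalar divergence of |.|^p, and
   <u_i, (B - A) v_j> = (b_j - a_i) <u_i, v_j>. The scalar inequality
     D(a, b) >= p (p - 1) / 2 * (b - a)^2 * ((2 |a|^p + |b|^p) / 3)^-eta,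
   with eta = (2 - p) / p, thus reduces the claim to a lower bound for a
   quadratic form in B - A, whose weights are powers of sums of a function of i
   and a function of j. By Cauchy-Schwarz and operator concavity of t^eta, in
   the form of a Jensen inequality in the eigenbasis of B - A, this form is
   compared with a diagonal one, and Hoelder's inequality concludes.
   Applied at the base point w = g x + (1 - g) y of the ball, the bound gives
     ||w||^p <= r^p - p (p - 1) / 2 * r^(p - 2) * g (1 - g) ||x - y||^2,
   and Bernoulli's inequality turns it into the required gap between ||w|| and
   r. Rectangular matrices are handled through the symmetric dilation
   [[0, X], [X^T, 0]], and the Frobenius norm by comparing norms. *)

Require Import Defs.
From mathcomp Require Import all_boot all_order all_algebra.
From mathcomp Require Import boolp classical_sets reals exp convex.
From mathcomp Require Import interval_inference functions.
From mathcomp Require Import topology normedtype derive realfun.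
From mathcomp Require Import spectral sesquilinear polyrcf complex ring lra.

Set Implicit Arguments.
Unset Strict Implicit.
Unset Printing Implicit Defensive.

Import Order.TTheory GRing.Theory Num.Theory.
Import numFieldNormedType.Exports.
Local Open Scope ring_scope.

(** * Real powers *)

Section scalar.
Variable R : realType.
Implicit Types a b p s t x : R.

(** Young's inequality for the product of [t] and 1, with exponent [p] on [t]. *)
Lemma powR_ge_tangent p t : 1 <= p -> 0 <= t -> 1 + p * (t - 1) <= t `^ p.
Proof.
rewrite le_eqVlt => /predU1P[<- t0|p1 t0]; first by rewrite powRr1 //; lra.
have p0 : 0 < p by lra.
have := @conjugate_powR R t 1 p (1 - p^-1)^-1 t0 ler01 p0.
rewrite invr_gt0 subr_gt0 invf_lt1 // p1 invrK addrC subrK => /(_ isT erefl).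
rewrite mulr1 powR1 mul1r -(ler_pM2r p0) mulrDl divfK ?gt_eqF //.
by rewrite mulrBl mul1r mulVf ?gt_eqF //; lra.
Qed.

(** This is [powR_ge_tangent] with exponent [s^-1] at the point [t ^ s]. *)
Lemma powR_le_tangent s t : 0 <= s <= 1 -> 0 <= t -> t `^ s <= 1 + s * (t - 1).
Proof.
case/andP; rewrite le_eqVlt => /predU1P[<- _ _|s0 s1 t0].
  by rewrite powRr0; lra.
have := @powR_ge_tangent s^-1 (t `^ s) _ (powR_ge0 _ _).
rewrite invf_ge1 // s1 -powRrM divff ?gt_eqF // powRr1 // => /(_ isT).
by rewrite -(ler_pM2l s0) mulrDr mulVKf ?gt_eqF //; lra.
Qed.

(** With [u = s (t - 1)], the upper tangent for [t ^ s] reduces the claim to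
    [(1 - u) (1 + u) <= 1]. *)
Lemma powRN_ge_tangent s t :
  0 <= s <= 1 -> 0 < t -> 1 - s * (t - 1) <= t `^ (- s).
Proof.
move=> s01 t0; rewrite powRN -[leRHS]div1r ler_pdivlMr ?powR_gt0 //.
have [c0|c0] := leP (1 - s * (t - 1)) 0.
  by apply: le_trans ler01; rewrite mulr_le0_ge0 ?powR_ge0.
apply: le_trans (ler_wpM2l (ltW c0) (powR_le_tangent s01 (ltW t0))) _.
by set u := s * (t - 1); nra.
Qed.

(** The mean value theorem is applied twice: to [f] on [0, 1], giving a slope [f' c], then to [f']
    on [0, c]. *)
Lemma taylor1_le (f f' f'' : R -> R) :
  (forall t, 0 <= t <= 1 -> is_derive t 1 f (f' t)) ->
  (forall t, 0 <= t <= 1 -> is_derive t 1 f' (f'' t)) ->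
  (forall t, 0 <= t <= 1 -> 0 <= f'' t) -> f 0 + f' 0 <= f 1.
Proof.
move=> df df' f''0.
have mvt (g g' : R -> R) : (forall t, 0 <= t <= 1 -> is_derive t 1 g (g' t)) ->
    forall x, 0 <= x <= 1 -> exists2 c, 0 <= c <= x & g x - g 0 = g' c * x.
  move=> dg x /andP[x0 x1].
  have [t| |c] := @MVT_segment R g g' 0 x x0.
  - rewrite in_itv /= => /andP[t0 tx]; apply: dg.
    by rewrite ltW //= (le_trans (ltW tx)).
  - apply: derivable_within_continuous => t.
    rewrite in_itv /= => /andP[t0 tx]; apply: ex_derive; apply: dg.
    by rewrite t0 (le_trans tx).
  by rewrite in_itv /= subr0 => ? ?; exists c.
have [|c c01] := mvt _ _ df 1; first by rewrite ler01 lexx.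
rewrite mulr1 => fc.
have [d /andP[d0 dc] f'c] := mvt _ _ df' c c01.
have : 0 <= f'' d * c.
  by case/andP: c01 => c0 c1; rewrite mulr_ge0 // f''0 // d0 (le_trans dc).
lra.
Qed.

End scalar.

(** * Scalar Bregman divergence of the p-th power *)

Section bregman.
Variables (R : realType) (p : R).
Hypothesis hp : 1 < p <= 2.
Implicit Types a b : R.
(** With this exponent [(v ^ p) ^ (- eta)] is [v ^ (p - 2)], the power in the second derivative of
    [v ^ p]. *)
Let eta := (2 - p) / p.

Let p0 : 0 < p. Proof. by case/andP: hp; lra. Qed.

Let eta01 : 0 <= eta < 1.
Proof.
case/andP: hp => p1 p2; rewrite /eta divr_ge0 ?subr_ge0 // ?(ltW p0) //.
by rewrite ltr_pdivrMr // mul1r; lra.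
Qed.

Let eta01' : 0 <= eta <= 1.
Proof. by case/andP: eta01 => -> /ltW. Qed.

Let etap : eta * p = 2 - p.
Proof. by rewrite /eta divfK ?gt_eqF. Qed.

(* The mean of (1 - s) |a|^p + s |b|^p for the density 2 (1 - s) on [0, 1],
   which is the weight of the second derivative in Taylor's formula. *)
Definition mean_pow a b := (2 * `|a| `^ p + `|b| `^ p) / 3.

(* Along the segment v = a + t h, the tangent of y^-eta at x bounds the second
   derivative p (p - 1) h^2 (v^p)^-eta below by an affine function of v^p, and
   convexity of y^p turns it into an affine function of t. The cubic polynomial
   c2 t^2 + c3 t^3 has that second derivative, and takes the value C at 1. *)
Lemma bregman_powR_gt0 a b : 0 < a -> 0 < b ->
  p * (p - 1) / 2 * (b - a) ^+ 2 * mean_pow a b `^ (- eta)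
  <= b `^ p - a `^ p - p * a `^ (p - 1) * (b - a).
Proof.
move=> a0 b0; rewrite /mean_pow !gtr0_norm //.
have al0 : 0 < a `^ p by rewrite powR_gt0.
have be0 : 0 < b `^ p by rewrite powR_gt0.
set al := a `^ p in al0 *; set be := b `^ p in be0 *.
set x := (2 * al + be) / 3.
have x0 : 0 < x by rewrite divr_gt0 // addr_gt0 // mulr_gt0.
set C := p * (p - 1) / 2 * _ * _.
pose h := b - a.
have pos t : 0 <= t <= 1 -> 0 < a + t * h.
  have -> : a + t * h = (1 - t) * a + t * b by rewrite /h; ring.
  move=> /andP[+ t1]; rewrite le_eqVlt => /predU1P[<-|t0].
    by rewrite subr0 mul1r mul0r addr0.
  by rewrite ltr_wpDl ?mulr_gt0 // mulr_ge0 ?subr_ge0 // ltW.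
pose c2 := C * (1 + eta - eta / x * al);
  pose c3 := C * (- (eta / x) * (be - al) / 3).
have dpow (q t : R) : 0 <= t <= 1 ->
    is_derive t 1 (fun s : R => (a + s * h) `^ q)
      (q * (a + t * h) `^ (q - 1) * h).
  move=> /pos t0.
  have -> : (fun s : R => (a + s * h) `^ q) =
    (@powR R ^~ q) \o (fun s : R => a + s * h) by [].
  apply: is_derive1_comp; first exact: is_derive1_powR.
  have D := is_deriveD (is_derive_cst a t 1)
    (is_deriveM (is_derive_id t 1) (is_derive_cst h t 1)).
  by apply: (is_derive_eq D); rewrite scaler0 !add0r [h *: 1]mulr1.
have v_le t : 0 <= t <= 1 -> (a + t * h) `^ p <= al + (be - al) * t.
  move=> t01; have v0 := pos _ t01; case/andP: t01 => t0 t1.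
  set v := a + t * h in v0 *; have vp : 0 < v `^ p by rewrite powR_gt0.
  (* The tangent of [y ^ p] at [v], by homogeneity. Averaged over [c = a] and [c = b], whose
     weighted mean is [v], its linear part vanishes. *)
  have tg c : 0 < c -> v `^ p * (1 + p * (c / v - 1)) <= c `^ p.
    move=> c0; rewrite -[c in leRHS](divfK (lt0r_neq0 v0)) mulrC.
    have cv0 : 0 <= c / v by rewrite divr_ge0 // ltW.
    rewrite powRM ?(ltW v0) // ler_wpM2r ?(ltW vp) // powR_ge_tangent //.
    by case/andP: hp => /ltW.
  have s0 : 0 <= 1 - t by rewrite subr_ge0.
  have := lerD (ler_wpM2l s0 (tg a a0)) (ler_wpM2l t0 (tg b b0)).
  rewrite -/al -/be => H; apply: le_trans (le_trans H _); last by nra.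
  have -> : (1 - t) * (v `^ p * (1 + p * (a / v - 1))) +
     t * (v `^ p * (1 + p * (b / v - 1))) =
     v `^ p * (1 + p * (((1 - t) * a + t * b) / v - 1)) by ring.
  have -> : (1 - t) * a + t * b = v by rewrite /v /h; ring.
  by rewrite divff ?gt_eqF // subrr mulr0 addr0 mulr1.
have := @taylor1_le R
  (fun s => (a + s * h) `^ p - (c2 * (s * s) + c3 * (s * (s * s))))
  (fun s => p * (a + s * h) `^ (p - 1) * h - (2 * c2 * s + 3 * c3 * (s * s)))
  (fun s => p * ((p - 1) * (a + s * h) `^ (p - 1 - 1) * h) * h
    - (2 * c2 + 6 * c3 * s)).
(* Here the weights 2/3 and 1/3 of the mean matter: [al + (be - al) / 3 = x], so the terms in [eta]
   cancel. *)
have -> : C = c2 + c3.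
  rewrite /c2 /c3 -mulrDr -[LHS]mulr1; congr (_ * _).
  have : eta / x * x = eta by rewrite divfK ?gt_eqF.
  by rewrite {2}/x; lra.
rewrite !(mul0r, expr0n, addr0, mul1r, mulr0, subr0, expr1n, mulr1) /=.
have -> : a + h = b by rewrite /h; ring.
rewrite -/al -/be => H; suff : al + p * a `^ (p - 1) * h <= be - (c2 + c3).
  by rewrite -/h; lra.
apply: H => t t01.
- have id2 := is_deriveM (is_derive_id t 1) (is_derive_id t 1).
  have D := is_deriveB (dpow p t t01) (is_deriveD
    (is_deriveM (is_derive_cst c2 t 1) id2)
    (is_deriveM (is_derive_cst c3 t 1) (is_deriveM (is_derive_id t 1) id2))).
  by apply: (is_derive_eq D); rewrite !fctE -![_ *: _]/(_ * _) /=; ring.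
- have id2 := is_deriveM (is_derive_id t 1) (is_derive_id t 1).
  have D := is_deriveB
    (is_deriveM (is_deriveM (is_derive_cst p t 1) (dpow (p - 1) t t01))
      (is_derive_cst h t 1)) (is_deriveD
    (is_deriveM (is_derive_cst (2 * c2) t 1) (is_derive_id t 1))
    (is_deriveM (is_derive_cst (3 * c3) t 1) id2)).
  by apply: (is_derive_eq D); rewrite !fctE -![_ *: _]/(_ * _) /=; ring.
- have v0 := pos _ t01.
  have : x `^ (- eta) * (1 + eta - eta / x * (al + (be - al) * t)) <=
    (a + t * h) `^ (p - 1 - 1).
    have -> : p - 1 - 1 = p * - eta by rewrite mulrN mulrC etap; ring.
    rewrite powRrM; have vp := @powR_gt0 _ (a + t * h) p v0.
    have -> : (a + t * h) `^ p = x * ((a + t * h) `^ p / x).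
      by rewrite mulrCA divff ?mulr1 ?gt_eqF.
    rewrite (powRM _ (ltW x0) (ltW (divr_gt0 vp x0))).
    rewrite ler_wpM2l ?powR_ge0 //.
    apply: le_trans (powRN_ge_tangent eta01' (divr_gt0 vp x0)).
    have := v_le _ t01; rewrite -(ler_pM2r (_ : 0 < x^-1)) ?invr_gt0 // => H1.
    have := ler_wpM2l (proj1 (andP eta01)) H1; lra.
  have k0 : 0 <= p * (p - 1) * h ^+ 2.
    by case/andP: hp => p1 _; rewrite mulr_ge0 ?sqr_ge0 // mulr_ge0 ?(ltW p0)
      // subr_ge0 ltW.
  move=> /(ler_wpM2l k0).
  rewrite /c2 /c3 /C -/h; lra.
Qed.

Let scale_powR k c : 0 < k ->
  (k * c `^ p) `^ (- eta) = k `^ (- eta) * c `^ (p - 2).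
Proof.
move=> k0; rewrite powRM ?powR_ge0 ?(ltW k0) // -powRrM mulrN (mulrC p) etap.
by rewrite opprB.
Qed.

Let sqr_powRB c : 0 < c -> c ^+ 2 * c `^ (p - 2) = c `^ p.
Proof.
move=> c0; rewrite -powR_mulrn ?(ltW c0) // -powRD ?(gt_eqF c0) ?implybT //.
by congr (_ `^ _); ring.
Qed.

Let powRV_le k : 0 < k -> k `^ (- eta) <= 1 + eta * (k^-1 - 1).
Proof.
move=> k0; rewrite powRN -[leLHS]powR_inv1 ?powR_ge0 // powRAC powR_inv1
  ?(ltW k0) //.
by rewrite powR_le_tangent // invr_ge0 ltW.
Qed.

(** The case of two positive numbers is extended by reflection. For opposite signs [b] is replaced
    by [- b], a negative [a] is treated by negating both, and when one number is 0 the mean is a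
    multiple of a single p-th power, so only constants are compared. *)
Lemma bregman_powR a b :
  p * (p - 1) / 2 * (b - a) ^+ 2 * mean_pow a b `^ (- eta)
  <= `|b| `^ p - `|a| `^ p - p * (Num.sg a * `|a| `^ (p - 1)) * (b - a).
Proof.
have [p1 p2] := andP hp.
have p10 : 0 <= p - 1 by lra.
have etap' := etap; have /andP[eta0 _] := eta01.
have k23 : 0 < 2 / 3 :> R by lra.
have k23_le : (2 / 3) `^ (- eta) <= 1 + eta / 2.
  by apply: le_trans (powRV_le k23) _; rewrite le_eqVlt; apply/orP; left;
    apply/eqP; field.
have pos_case a' b' : 0 < a' ->
  p * (p - 1) / 2 * (b' - a') ^+ 2 * mean_pow a' b' `^ (- eta)
  <= `|b'| `^ p - `|a'| `^ p - p * (Num.sg a' * `|a'| `^ (p - 1)) * (b' - a').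
  move=> a0; rewrite gtr0_sg // mul1r.
  have ap0 : 0 < a' `^ p by rewrite powR_gt0.
  have [b0|b0|->] := ltrgt0P b'.
  - by rewrite (gtr0_norm a0); exact: bregman_powR_gt0.
  - rewrite (gtr0_norm a0) /mean_pow (ltr0_norm b0) (gtr0_norm a0).
    have := bregman_powR_gt0 a0 (_ : 0 < - b').
    rewrite oppr_gt0 /mean_pow normrN (ltr0_norm b0) (gtr0_norm a0) => /(_ b0).
    move: b0; rewrite -oppr_gt0; set c := - b';
      have -> : b' = - c by rewrite opprK.
    move=> c0.
    set x := (_ / 3) `^ _ => H.
    (* Passing from (a', c) to (a', - c) adds 2 p a'^(p - 1) c to the right-hand
       side and 2 p (p - 1) a' c x to the left-hand side. *)
    suff : (p - 1) * a' * x <= a' `^ (p - 1).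
      move=> /(ler_wpM2l (ltW c0)) /(ler_wpM2l (ltW p0)); move: H; lra.
    have -> : p - 1 = (1 + (p - 2)) by ring.
    rewrite powRD ?(gt_eqF a0) ?implybT // powRr1 ?(ltW a0) //.
    have -> : 1 + (p - 2) = p - 1 by ring.
    rewrite mulrAC [leRHS]mulrC ler_wpM2r ?(ltW a0) //.
    (* Dropping [c ^ p] from the mean can only increase its negative power. *)
    have x_le : x <= (2 / 3) `^ (- eta) * a' `^ (p - 2).
      rewrite -(scale_powR _ k23) /x !powRN lef_pV2 ?posrE ?powR_gt0 //;
        last 2 first.
      - by rewrite divr_gt0 // addr_gt0 ?powR_gt0 // mulr_gt0.
      - by rewrite mulr_gt0.
      rewrite ge0_ler_powR ?nnegrE //.
      - by rewrite mulr_ge0 ?powR_ge0 // ltW.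
      - by rewrite divr_ge0 // addr_ge0 ?powR_ge0 // mulr_ge0 ?powR_ge0.
      - have := powR_ge0 c p; lra.
    apply: le_trans (ler_wpM2l p10 x_le) _.
    rewrite mulrA -[leRHS]mul1r ler_wpM2r ?powR_ge0 //.
    apply: le_trans (ler_wpM2l p10 k23_le) _.
    (* Since [eta * p = 2 - p], this amounts to [(p - 2) (p + 1) <= 0]. *)
    nra.
  - rewrite powR0 ?gt_eqF // sub0r sqrrN gtr0_norm // /mean_pow normr0 powR0
    ?gt_eqF //.
    rewrite gtr0_norm // addr0 (mulrAC 2) scale_powR
      // -mulrA (mulrCA (a' ^+ 2)) sqr_powRB //.
    have -> : p * a' `^ (p - 1) * - a' = - (p * a' `^ p).
      by rewrite -(mulr_powRB1 (ltW a0) p0); ring.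
    have := ler_wpM2r (ltW ap0) k23_le.
    have k : 0 <= p * (p - 1) / 2 by nra.
    move/(ler_wpM2l k) => H; apply: le_trans H _.
    suff : p * (p - 1) / 2 * (1 + eta / 2) <= (p - 1).
      by move/(ler_wpM2r (ltW ap0)); lra.
    nra.
have [a0|a0|->] := ltrgt0P a.
- by have := pos_case a b a0; rewrite (gtr0_norm a0).
- have := pos_case (- a) (- b).
  rewrite oppr_gt0 /mean_pow !normrN sgrN => /(_ a0).
  have -> : - b - - a = - (b - a) by ring.
  rewrite sqrrN (ltr0_norm a0); lra.
- rewrite /mean_pow sgr0 normr0 subr0 powR0 ?gt_eqF //.
  rewrite !(mul0r, mulr0, subr0, add0r).
  have [->|b0] := eqVneq b 0; first by rewrite expr0n /= mulr0 mul0r powR_ge0.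
  have nb0 : 0 < `|b| by rewrite normr_gt0.
  have bp0 : 0 < `|b| `^ p by rewrite powR_gt0.
  rewrite (mulrC (`|b| `^ p)) scale_powR ?invr_gt0
    // -(real_normK (num_real b)).
  rewrite -mulrA (mulrCA (`|b| ^+ 2)) sqr_powRB
    // mulrA -[leRHS]mul1r ler_wpM2r ?(ltW bp0) //.
  have k : 0 <= p * (p - 1) / 2 by nra.
  apply: le_trans (ler_wpM2l k (powRV_le _)) _; first by rewrite invr_gt0.
  rewrite invrK; nra.
Qed.

End bregman.

(** * Spectral theorem for real symmetric matrices *)

Section spectral.
Variable R : realType.

(** The eigenvectors are the rows of [P], so [P *m Q^T] collects the inner products between the
    vectors of two eigenbases. *)
Definition spectral n (A P : 'M[R]_n) (a : 'rV[R]_n) :=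
  P *m P^T = 1%:M /\ A = P^T *m diag_mx a *m P.

Lemma rV_dotE n (u v : 'rV[R]_n) : (u *m v^T) 0 0 = \sum_j u 0 j * v 0 j.
Proof. by rewrite mxE; apply: eq_bigr => j _; rewrite mxE. Qed.

Lemma rV_dot_eq0 n (u : 'rV[R]_n) : ((u *m u^T) 0 0 == 0) = (u == 0).
Proof.
rewrite rV_dotE psumr_eq0 => [|j _]; last by rewrite -expr2 sqr_ge0.
apply/allP/eqP => [u0|-> j _]; last by rewrite /= mxE mul0r eqxx.
apply/rowP => j; rewrite mxE; apply/eqP.
by have := u0 j (mem_index_enum j); rewrite mulf_eq0 orbb.
Qed.

(** Over the complex numbers the matrix is Hermitian, so its spectral diagonal is real. Being a root
    of the characteristic polynomial then descends along the embedding of the reals. *)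
Lemma symmetric_eigenvalue n (A : 'M[R]_n.+1) : A^T
  = A -> exists a, eigenvalue A a.
Proof.
move=> symA; pose f := real_complex R; pose Ac := map_mx f A.
have hAc : Ac \is hermsymmx.
  apply: realsym_hermsym.
    apply/is_hermitianmxP; rewrite expr0 scale1r.
    by apply/matrixP => i j; rewrite !mxE -[in LHS]symA mxE.
  by apply/mxOverP => i j; rewrite mxE; apply/complex_realP; exists (A i j).
have /hermitian_normalmx/orthomx_spectralP Aceq := hAc.
have /mxOverP/(_ ord0 ord0)/complex_realP[a aE] := hermitian_spectral_diag_real
  hAc.
exists a; rewrite eigenvalue_root_char -(fmorph_root f) map_char_poly -/Ac.
rewrite -eigenvalue_root_char; apply/eigenvalueP.
have Pu := spectral_unit Ac.
exists (row 0 (spectralmx Ac)); last first.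
  rewrite rowE; apply/eqP => /(congr1 (mulmx^~ (invmx (spectralmx Ac)))).
  rewrite mulmxK // mul0mx => /matrixP/(_ 0 0)/eqP.
  by rewrite !mxE oner_eq0.
rewrite -row_mul {2}Aceq !mulmxA mulmxV // mul1mx row_mul row_diag_mx.
by rewrite aE -scalemxAl -rowE.
Qed.

(* The matrix is the Householder reflection exchanging the first basis vector
   and v. *)
Lemma unit_row_orthogonal n (v : 'rV[R]_n.+1) : v *m v^T = 1%:M ->
  exists2 Q : 'M[R]_n.+1, Q *m Q^T = 1%:M & delta_mx 0 0 *m Q = v.
Proof.
move=> vv; pose e : 'rV[R]_n.+1 := delta_mx 0 0;
  have [u uE] : exists u, u = v - e by exists (v - e).
have [u0|u0] := eqVneq u 0.
  exists 1%:M; first by rewrite trmx1 mulmx1.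
  by rewrite mulmx1; apply/esym/eqP; rewrite -subr_eq0 -/e -uE u0.
pose c := (u *m u^T) 0 0.
have c0 : c != 0 by rewrite rV_dot_eq0.
have ee : e *m e^T = 1%:M.
  by rewrite trmx_delta mul_delta_mx; apply/matrixP => i j; rewrite !ord1 !mxE.
have ve : v *m e^T = (v 0 0)%:M.
  by apply/matrixP => i j; rewrite !ord1 trmx_delta -colE !mxE.
have ev : e *m v^T = (v 0 0)%:M.
  by rewrite -[LHS]trmxK trmx_mul trmxK ve tr_scalar_mx.
have cE : c = 2 - 2 * v 0 0.
  rewrite /c uE linearB /= mulmxBl !mulmxBr vv ve ev ee !mxE /=; ring.
exists (1%:M - (2 / c) *: (u^T *m u)).
  have -> : (1%:M - (2 / c) *: (u^T *m u))^T = 1%:M - (2 / c) *: (u^T *m u).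
    by apply/matrixP => i j; rewrite !mxE (eq_sym j); congr (_ - _ * _);
      apply: eq_bigr => k _; rewrite !mxE mulrC.
  rewrite mulmxBl mul1mx mulmxBr mulmx1 -scalemxAl -scalemxAr.
  have -> : u^T *m u *m (u^T *m u) = c *: (u^T *m u).
    by rewrite mulmxA -(mulmxA u^T) (mx11_scalar (u *m u^T)) -/c mul_mx_scalar
      scalemxAl.
  rewrite !scalerA; move: (u^T *m u) => M.
  by apply/matrixP => i j; rewrite !mxE; field.
rewrite mulmxBr mulmx1 -scalemxAr mulmxA -/e.
have -> : e *m u^T = ((- c / 2)%:M : 'M_1).
  rewrite uE linearB /= mulmxBr ev ee cE; apply/matrixP => i j.
  by rewrite !ord1 !mxE /=; field.
rewrite mul_scalar_mx scalerA (_ : 2 / c * (- c / 2) = -1); last by field.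
by rewrite scaleN1r opprK uE addrC subrK.
Qed.

(** Induction by deflation: an orthogonal [Q] takes the first basis vector to a unit eigenvector.
    The first row of [Q *m A *m Q^T] is then a multiple of that basis vector, and symmetry makes the
    matrix block diagonal. *)
Lemma symmetric_spectral n (A : 'M[R]_n) :
  A^T = A -> exists P a, spectral A P a.
Proof.
elim: n A => [|n IH] A symA.
  by exists 1%:M, 0; split; apply/matrixP; case.
have [a /eigenvalueP[w wA w0]] := symmetric_eigenvalue symA.
have ww0 : 0 < (w *m w^T) 0 0.
  rewrite lt0r rV_dot_eq0 w0 rV_dotE sumr_ge0 // => j _.
  by rewrite -expr2 sqr_ge0.
pose v := (Num.sqrt ((w *m w^T) 0 0))^-1 *: w.
have vv : v *m v^T = 1%:M.
  have -> : v^T = (Num.sqrt ((w *m w^T) 0 0))^-1 *: w^T.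
    by apply/matrixP => i j; rewrite !mxE.
  rewrite /v -scalemxAl -scalemxAr scalerA -invfM -expr2 sqr_sqrtr ?ltW //.
  by rewrite {2}(mx11_scalar (w *m w^T)) scale_scalar_mx mulVf ?gt_eqF.
have vA : v *m A = a *: v by rewrite -scalemxAl wA scalerA mulrC -scalerA.
have [Q QQ eQ] := unit_row_orthogonal vv.
have QQ' : Q^T *m Q = 1%:M by exact: mulmx1C.
have [B BdefE] : exists B : 'M_(1 + n), B = Q *m A *m Q^T
  by exists (Q *m A *m Q^T).
have symB : B^T = B by rewrite BdefE !trmx_mul trmxK symA mulmxA.
have rowB : row 0 B = a *: delta_mx 0 0.
  rewrite BdefE !row_mul rowE eQ vA -scalemxAl -eQ -mulmxA QQ mulmx1 //.
have B0 j : B 0 j = a *+ (j == 0).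
  by have /rowP/(_ j) := rowB; rewrite !mxE eqxx mulr_natr.
have l0 : lshift n (0 : 'I_1) = 0 :> 'I_(1 + n) by apply: val_inj.
have ulB : ulsubmx B = a%:M.
  by apply/matrixP => i j; rewrite !ord1 !mxE l0 B0.
have urB : ursubmx B = 0.
  by apply/matrixP => i j; rewrite !ord1 !mxE l0 B0.
have dlB : dlsubmx B = 0.
  by rewrite -symB -trmx_ursub urB trmx0.
have [|P [d [PP dE]]] := IH (drsubmx B).
  by rewrite trmx_drsub symB.
pose P' : 'M_(1 + n) := block_mx 1%:M 0 0 P.
pose d' : 'rV_(1 + n) := row_mx a%:M d.
have BE : B = P'^T *m diag_mx d' *m P'.
  rewrite -(submxK B) ulB urB dlB /P' tr_block_mx !trmx0 trmx1 diag_mx_row.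
  rewrite !mulmx_block !(mul1mx, mulmx1, mul0mx, mulmx0, addr0, add0r) -dE.
  by congr block_mx; apply/matrixP => i j; rewrite !ord1 !mxE.
have PP' : P' *m P'^T = 1%:M.
  rewrite /P' tr_block_mx !trmx0 trmx1 mulmx_block.
  by rewrite !(mul1mx, mulmx1, mul0mx, mulmx0, addr0, add0r) PP
    -scalar_mx_block.
exists (P' *m Q), d'; split.
  by rewrite trmx_mul mulmxA -(mulmxA P') QQ mulmx1 PP'.
rewrite trmx_mul -!mulmxA (mulmxA P'^T) (mulmxA (P'^T *m _)) -BE BdefE.
by rewrite -!mulmxA QQ' mulmx1 !mulmxA QQ' mul1mx.
Qed.

Lemma spectral_quad n (A P : 'M[R]_n) (a : 'rV[R]_n) (z : 'rV[R]_n) :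
  spectral A P a -> (z *m A *m z^T) 0 0 = \sum_i a 0 i * ((z *m P^T) 0 i) ^+ 2.
Proof.
case=> _ ->; have -> : z *m (P^T *m diag_mx a *m P) *m z^T =
    (z *m P^T *m diag_mx a) *m (z *m P^T)^T.
  by rewrite trmx_mul trmxK !mulmxA.
rewrite rV_dotE; apply: eq_bigr => i _; rewrite mul_mx_diag [X in X * _]mxE.
by rewrite expr2 mulrCA mulrA.
Qed.

Lemma quad_le_eigen n (K : 'M[R]_n) (c : R) : K^T = K ->
  (forall (z : 'rV[R]_n) lam, z != 0 -> z *m K = lam *: z -> lam <= c) ->
  forall z : 'rV[R]_n, (z *m K *m z^T) 0 0 <= c * (z *m z^T) 0 0.
Proof.
move=> symK eig z; have [P [a spK]] := symmetric_spectral symK.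
rewrite (spectral_quad _ spK); case: spK => PP KE.
have -> : (z *m z^T) 0 0 = \sum_i ((z *m P^T) 0 i) ^+ 2.
  rewrite -[z *m z^T]/(z *m z^T) -{1}[z]mulmx1 -(mulmx1C PP) mulmxA -mulmxA.
  by rewrite -{2}[P]trmxK -trmx_mul rV_dotE.
rewrite mulr_sumr ler_sum // => i _; rewrite ler_wpM2r ?sqr_ge0 //.
apply: (eig (row i P)).
  rewrite rowE; apply/eqP => /(congr1 (mulmx^~ P^T)).
  rewrite -mulmxA PP mulmx1 mul0mx => /matrixP/(_ 0 i)/eqP.
  by rewrite !mxE !eqxx oner_eq0.
rewrite -row_mul KE !mulmxA PP mul1mx row_mul row_diag_mx -scalemxAl -rowE //.
Qed.

End spectral.

(** * Operator Jensen inequality *)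

Section jensen.
Variable R : realType.

Lemma powR_half_sqr (y e : R) : (y `^ (e / 2)) ^+ 2 = y `^ e.
Proof. by rewrite -powR_mulrn ?powR_ge0 // -powRrM divfK ?pnatr_eq0. Qed.

Lemma cauchy_schwarz_sum (I : finType) (f g : I -> R) :
  (\sum_i f i * g i) ^+ 2 <= (\sum_i f i ^+ 2) * (\sum_i g i ^+ 2).
Proof.
set a := \sum_i f i ^+ 2; set b := \sum_i f i * g i; set c := \sum_i g i ^+ 2.
have a0 : 0 <= a by apply: sumr_ge0 => i _; exact: sqr_ge0.
have q s : 0 <= s ^+ 2 * a + 2 * s * b + c.
  rewrite /a /b /c !mulr_sumr -!big_split /=; apply: sumr_ge0 => i _.
  have -> : s ^+ 2 * f i ^+ 2 + 2 * s * (f i * g i) + g i ^+ 2 =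
    (s * f i + g i) ^+ 2 by ring.
  exact: sqr_ge0.
have [a_eq0|a_neq0] := eqVneq a 0.
  (* For [a = 0] and [b != 0] the polynomial is affine and would take the value -1 at this point. *)
  rewrite a_eq0 mul0r; have := q (- (c + 1) / (2 * b)).
  have [->|b0] := eqVneq b 0; first by rewrite expr0n.
  rewrite a_eq0 mulr0 add0r.
  have -> : 2 * (- (c + 1) / (2 * b)) * b = - (c + 1) by field.
  lra.
have {}a0 : 0 < a by rewrite lt0r a_neq0.
have := q (- b / a).
have -> : (- b / a) ^+ 2 * a + 2 * (- b / a) * b + c = (a * c - b ^+ 2) / a.
  by field.
by rewrite pmulr_lge0 ?invr_gt0 // subr_ge0.
Qed.

Section operator_jensen.
(** [x] is a positive diagonal operator, [w] an orthonormal family, and [d] the diagonal matrix of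
    the compression of [x] to the span of [w]. The aim is that the compression of [x ^ eta] is at
    most [d ^ eta]. *)
Variables (I : finType) (n : nat) (x : I -> R) (w : 'I_n -> I -> R) (d : 'I_n
  -> R).
Hypothesis x_gt0 : forall i, 0 < x i.
Hypothesis w_ortho : forall k l, \sum_i w k i * w l i = (k == l)%:R.
Hypothesis w_diag : forall k l, \sum_i x i * (w k i * w l i) = d k *+ (k == l).

Let d_gt0 k : 0 < d k.
Proof.
have := w_diag k k; rewrite eqxx mulr1n => <-.
have xw i : 0 <= x i * (w k i * w k i)
  by rewrite mulr_ge0 ?(ltW (x_gt0 i)) -?expr2 ?sqr_ge0.
rewrite lt0r sumr_ge0 // psumr_neq0 // andbT.
have /eqP := w_ortho k k; rewrite eqxx; apply: contraLR => /hasPn H.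
rewrite big1 ?(eq_sym 0) ?oner_eq0 // => i _.
apply/eqP; have := H i (mem_index_enum i); rewrite lt0r xw andbT negbK.
by rewrite mulf_eq0 gt_eqF.
Qed.

(** The compression of [x ^ eta], multiplied on both sides by [d ^ (- eta / 2)]. The aim becomes
    that this form is at most the squared norm of [z], and there is equality for [eta] equal to 0 or
    1. *)
Let T eta (z : 'rV[R]_n) :=
  \sum_i x i `^ eta * (\sum_k z 0 k * d k `^ (- (eta / 2)) * w k i) ^+ 2.

Let sqw i (c : 'I_n -> R) : (\sum_k c k * w k i) ^+ 2 =
  \sum_k \sum_l c k * c l * (w k i * w l i).
Proof.
rewrite expr2 big_distrlr /=; apply: eq_bigr => k _; apply: eq_bigr => l _.
by ring.
Qed.

Let T_quad (y : I -> R) (c : 'I_n -> R) :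
  \sum_i y i * (\sum_k c k * w k i) ^+ 2 =
  \sum_k \sum_l c k * c l * \sum_i y i * (w k i * w l i).
Proof.
under eq_bigr => i _ do rewrite sqw mulr_sumr.
rewrite exchange_big; apply: eq_bigr => k _.
under eq_bigr => i _ do rewrite mulr_sumr.
rewrite exchange_big; apply: eq_bigr => l _.
by rewrite mulr_sumr; apply: eq_bigr => i _; rewrite mulrCA.
Qed.

Let sq_ortho (c : 'I_n -> R) : \sum_i (\sum_k c k * w k i) ^+ 2
  = \sum_k c k ^+ 2.
Proof.
under eq_bigr => i _ do rewrite -[_ ^+ 2]mul1r.
rewrite (T_quad (fun=> 1)); apply: eq_bigr => k _.
rewrite (eq_bigr (fun l => c k * c l * (k == l)%:R)) => [|l _]; last first.
  by rewrite -w_ortho; congr (_ * _); apply: eq_bigr => i _; rewrite mul1r.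
rewrite (bigD1 k) //= eqxx mulr1 big1 ?addr0 // => l lk.
by rewrite eq_sym (negbTE lk) mulr0.
Qed.

Let T0 z : T 0 z = \sum_k z 0 k ^+ 2.
Proof.
rewrite /T; under eq_bigr => i _ do rewrite powRr0 mul1r mul0r oppr0.
by rewrite sq_ortho; apply: eq_bigr => k _; rewrite powRr0 mulr1.
Qed.

Let T1 z : T 1 z = \sum_k z 0 k ^+ 2.
Proof.
rewrite /T; under eq_bigr => i _ do rewrite powRr1 ?ltW //.
rewrite T_quad; apply: eq_bigr => k _.
under eq_bigr => l _ do rewrite w_diag.
rewrite (bigD1 k) //= eqxx mulr1n [X in _ + X]big1 ?addr0 => [|l lk];
  last first.
  by rewrite eq_sym (negbTE lk) mulr0.
rewrite -expr2 exprMn -mulrA powRN exprVn powR_half_sqr powRr1 ?ltW //.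
by rewrite mulVf ?mulr1 ?gt_eqF.
Qed.

(** A crude bound from [y ^ eta <= 1 + y]. What matters is that it does not depend on [eta]. *)
Let C := (1 + \sum_i x i) * (1 + \sum_k (d k)^-1).

Let T_bound eta z : 0 <= eta <= 1 -> T eta z <= C * \sum_k z 0 k ^+ 2.
Proof.
move=> eta01; have /andP[e0 e1] := eta01.
have le1 (y : R) : 0 < y -> y `^ eta <= 1 + y.
  move=> y0; apply: le_trans (powR_le_tangent eta01 (ltW y0)) _.
  by rewrite lerD2l; nra.
have X0 : 0 <= 1 + \sum_i x i by rewrite addr_ge0 // sumr_ge0 // => i _;
  exact: ltW.
apply: (@le_trans _ _ ((1 + \sum_i x i) *
    \sum_i (\sum_k z 0 k * d k `^ (- (eta / 2)) * w k i) ^+ 2)).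
  rewrite mulr_sumr; apply: ler_sum => i _; rewrite ler_wpM2r ?sqr_ge0 //.
  apply: le_trans (le1 _ (x_gt0 i)) _; rewrite lerD2l (bigD1 i) //= lerDl.
  by apply: sumr_ge0 => j _; exact: ltW.
rewrite /C -mulrA ler_wpM2l // sq_ortho mulr_sumr ler_sum // => k _.
rewrite exprMn mulrC ler_wpM2r ?sqr_ge0 //.
rewrite -mulNr powR_half_sqr.
rewrite powRN -[leLHS]powR_inv1 ?powR_ge0 // powRAC powR_inv1
  ?(ltW (d_gt0 k)) //.
apply: le_trans (le1 _ _) _; first by rewrite invr_gt0.
rewrite lerD2l (bigD1 k) //= lerDl.
by apply: sumr_ge0 => j _; rewrite invr_ge0 ltW.
Qed.

(* If z is an eigenvector of the quadratic form T m for lam, Cauchy-Schwarz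
   between the exponents m - t and m + t at the rescaled vector z' bounds lam;
   t is chosen so that one of these exponents is 0 or 1. *)
Let T_sqrt M : (forall eta z, 0 <= eta <= 1 -> T eta z <= M
  * \sum_k z 0 k ^+ 2) ->
  forall eta z, 0 <= eta <= 1 -> T eta z <= Num.sqrt M * \sum_k z 0 k ^+ 2.
Proof.
move=> TM m z /andP[m0 m1].
pose K : 'M[R]_n := \matrix_(k, l) (d k `^ (- (m / 2)) * d l `^ (- (m / 2)) *
   \sum_i x i `^ m * (w k i * w l i)).
have symK : K^T = K.
  apply/matrixP => k l; rewrite !mxE; congr (_ * _); first by rewrite mulrC.
  by apply: eq_bigr => i _; congr (_ * _); rewrite mulrC.
have TK : T m z = (z *m K *m z^T) 0 0.
  rewrite /T T_quad exchange_big /= rV_dotE; apply: eq_bigr => l _.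
  rewrite mxE mulr_suml; apply: eq_bigr => k _; rewrite mxE; ring.
have -> : \sum_k z 0 k ^+ 2 = (z *m z^T) 0 0.
  by rewrite rV_dotE; apply: eq_bigr => k _; rewrite expr2.
rewrite TK; apply: quad_le_eigen => // {z TK} z lam z0 zK.
have [lam0|lam0] := leP lam 0; first exact: le_trans lam0 (sqrtr_ge0 _).
suff lamM : lam ^+ 2 <= M.
  by rewrite -[lam]ger0_norm ?(ltW lam0) // -sqrtr_sqr ler_wsqrtr.
have cs t : 0 <= m - t <= 1 -> 0 <= m + t <= 1 -> (m - t = 0 \/ m + t
  = 1) -> lam ^+ 2 <= M.
  move=> mt1 mt2 mt01; pose z' : 'rV[R]_n := \row_k (z 0 k * d k `^ (t / 2)).
  pose S := \sum_k z' 0 k ^+ 2.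
  have S0 : 0 < S.
    rewrite lt0r sumr_ge0 ?andbT => [|k _]; last exact: sqr_ge0.
    rewrite psumr_neq0 => [|k _]; last exact: sqr_ge0.
    apply: contraNT z0 => /hasPn H; apply/eqP/rowP => k; rewrite mxE.
    have := H k (mem_index_enum k);
      rewrite /= lt0r sqr_ge0 andbT negbK sqrf_eq0.
    by rewrite mxE mulf_eq0 (gt_eqF (powR_gt0 _ (d_gt0 k))) orbF => /eqP.
  have TT : T (m - t) z' * T (m + t) z' <= M * S ^+ 2.
    have T0' e : 0 <= T e z'.
      by apply: sumr_ge0 => i _; rewrite mulr_ge0 ?powR_ge0 ?sqr_ge0.
    have [mt|mt] := mt01.
      by rewrite {1}mt T0 -/S mulrC expr2 mulrA ler_wpM2r ?(ltW S0) // TM.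
    by rewrite mt T1 -/S expr2 mulrA ler_wpM2r ?(ltW S0) // TM.
  have dt k (e : R) : d k `^ (t / 2) * d k `^ e = d k `^ (t / 2 + e).
    by rewrite -powRD // (gt_eqF (d_gt0 k)) implybT.
  (* The pairing of [g (m - t)] and [g (m + t)] is the bilinear form of [K] at [z] and the vector
     with entries [z k * d k ^ t]. As [z] is an eigenvector, it equals [lam * S]. *)
  have : (lam * S) ^+ 2 <= T (m - t) z' * T (m + t) z'.
    pose g e i := x i `^ (e / 2) * (\sum_k z' 0 k * d k `^ (- (e / 2)) * w k i).
    have gE e : T e z' = \sum_i g e i ^+ 2.
      by apply: eq_bigr => i _; rewrite /g exprMn powR_half_sqr.
    rewrite !gE; apply: le_trans (cauchy_schwarz_sum _ _).
    rewrite le_eqVlt; apply/orP; left; apply/eqP; congr (_ ^+ 2).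
    transitivity (\sum_k \sum_l z 0 k * d k `^ t * z 0 l * K l k).
      have -> : lam * S = \sum_k (z 0 k * d k `^ t) * (z *m K) 0 k.
        rewrite zK mulr_sumr; apply: eq_bigr => k _.
        by rewrite !mxE exprMn powR_half_sqr; ring.
      by apply: eq_bigr => k _; rewrite mxE mulr_sumr; apply: eq_bigr => l _;
        rewrite mulrA.
    have gg i : g (m - t) i * g (m + t) i = \sum_k \sum_l z 0 k * d k `^ t
      * z 0 l *
        (d l `^ (- (m / 2)) * d k `^ (- (m / 2)) * (x i `^ m * (w l i
          * w k i))).
      rewrite /g mulrACA -powRD ?(gt_eqF (x_gt0 i)) ?implybT // -mulrDl.
      have -> : (m - t + (m + t)) / 2 = m by field.
      rewrite big_distrlr /= mulr_sumr; apply: eq_bigr => k _.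
      rewrite mulr_sumr; apply: eq_bigr => l _; rewrite !mxE.
      have E1 : d k `^ (t / 2) * d k `^ (- ((m - t) / 2)) = d k `^ t
        * d k `^ (- (m / 2)).
        by rewrite dt -powRD ?(gt_eqF (d_gt0 k)) ?implybT //; congr (_ `^ _);
          field.
      have E2 : d l `^ (t / 2) * d l `^ (- ((m + t) / 2)) = d l `^ (- (m / 2)).
        by rewrite dt; congr (_ `^ _); field.
      by rewrite -(mulrA (z 0 k)) E1 -(mulrA (z 0 l)) E2; ring.
    under [RHS]eq_bigr => i _ do rewrite gg.
    rewrite [RHS]exchange_big; apply: eq_bigr => k _.
    rewrite [RHS]exchange_big; apply: eq_bigr => l _.
    by rewrite -mulr_sumr mxE -mulr_sumr.
  rewrite exprMn => /le_trans/(_ TT); rewrite ler_pM2r ?exprn_gt0 //.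
(* The two exponents are 0 and [2 m] in the first case, [2 m - 1] and 1 in the second. *)
have [m2|m2] := leP m (1 / 2).
  by apply: (cs m); [lra|lra|left; lra].
by apply: (cs (1 - m)); [lra|lra|right; lra].
Qed.

(* By T_sqrt the best constant valid for all eta in [0, 1] is at most its own
   square root, hence at most 1. *)
Lemma operator_jensen eta (z : 'I_n -> R) : 0 <= eta <= 1 ->
  \sum_i x i `^ eta * (\sum_k z k * w k i) ^+ 2 <= \sum_k z k ^+ 2 * d k `^ eta.
Proof.
move=> eta01.
pose P M := forall eta z, 0 <= eta <= 1 -> T eta z <= M * \sum_k z 0 k ^+ 2.
pose z' : 'rV[R]_n := \row_k (z k * d k `^ (eta / 2)).
suff P1 : P 1.
  have := P1 eta z' eta01; rewrite mul1r => H.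
  apply: le_trans (le_trans H _).
    rewrite le_eqVlt; apply/orP; left; apply/eqP; apply: eq_bigr => i _.
    congr (_ * _ ^+ 2); apply: eq_bigr => k _; congr (_ * _).
    by rewrite mxE -mulrA -powRD ?(gt_eqF (d_gt0 k)) ?implybT
      // subrr powRr0 mulr1.
  by apply: ler_sum => k _; rewrite mxE exprMn powR_half_sqr.
pose A : set R := [set M | 0 <= M /\ P M]%classic.
have C0 : 0 <= C.
  by rewrite mulr_ge0 // addr_ge0 // sumr_ge0 // => i _; rewrite ?invr_ge0 ltW.
have AC : A C by split=> // e v; exact: T_bound.
have infA : has_inf A by split; [exists C | exists 0 => M []].
have inf0 : 0 <= inf A by apply: lb_le_inf; [exists C | move=> M []].
(* The infimum is attained: for each fixed vector, the quotient of the two sides is a lower bound of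
   [A]. *)
have PA : P (inf A).
  move=> e v e01; have S0 : 0 <= \sum_k v 0 k ^+ 2.
    by apply: sumr_ge0 => k _; exact: sqr_ge0.
  have [S_eq0|S_neq0] := eqVneq (\sum_k v 0 k ^+ 2) 0.
    by have := T_bound v e01; rewrite S_eq0 !mulr0.
  have {}S0 : 0 < \sum_k v 0 k ^+ 2 by rewrite lt0r S_neq0.
  rewrite -ler_pdivrMr //; apply: lb_le_inf; first by exists C.
  by move=> M [_ PM]; rewrite ler_pdivrMr //; exact: PM.
have : inf A <= Num.sqrt (inf A).
  by apply: ge_inf; [exact: infA.2 | split; [exact: sqrtr_ge0 | exact: T_sqrt]].
move: PA inf0; set M := inf A => PM M0 MM.
have M1 : M <= 1.
  have := sqr_sqrtr M0; have := sqrtr_ge0 M; nra.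
move=> e v e01; apply: le_trans (PM _ _ e01) _.
by rewrite ler_wpM2r // sumr_ge0 // => k _; exact: sqr_ge0.
Qed.

End operator_jensen.

End jensen.

(** * Bregman divergence of the p-th power of the Schatten norm *)

Section trace_bregman.
Variable R : realType.

(** The tangent bound for the power [s] at [v / u], multiplied by [u]. *)
Lemma powR_young (s u v : R) : 0 <= s <= 1 -> 0 <= u -> 0 <= v ->
  u `^ (1 - s) * v `^ s <= (1 - s) * u + s * v.
Proof.
move=> s01 u0 v0; have /andP[s0 s1] := s01.
have [->|u_neq0] := eqVneq u 0.
  (* For [s = 1] the factor [0 ^ (1 - s)] is 1, not 0. *)
  rewrite mulr0 add0r; have [->|s_neq1] := eqVneq s 1.
    by rewrite subrr powRr0 powRr1.
  by rewrite powR0 ?mul0r ?mulr_ge0 // subr_eq0 eq_sym.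
have {}u0 : 0 < u by rewrite lt0r u_neq0.
have vu : 0 <= v / u by rewrite divr_ge0 // ltW.
have := ler_wpM2l (ltW u0) (powR_le_tangent s01 vu).
have -> : u * (v / u) `^ s = u `^ (1 - s) * v `^ s.
  rewrite powRM ?invr_ge0 ?(ltW u0)
    // -(powR_inv1 (ltW u0)) -powRrM mulN1r mulrCA mulrC.
  by rewrite powRD ?u_neq0 ?implybT // powRr1 ?(ltW u0).
have -> // : u * (1 + s * (v / u - 1)) = (1 - s) * u + s * v by field.
Qed.

Lemma powR_div (u v s : R) : 0 <= u -> 0 < v -> (u / v) `^ s = u `^ s / v `^ s.
Proof.
move=> u0 v0; rewrite powRM ?invr_ge0 ?(ltW v0)
  // -(powR_inv1 (ltW v0)) -powRrM.
by rewrite mulN1r powRN.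
Qed.

(** Young's inequality, summed after dividing each family by its total. *)
Lemma powR_hoelder (I : finType) (s : R) (u v : I -> R) : 0 <= s <= 1 ->
  (forall i, 0 <= u i) -> (forall i, 0 <= v i) ->
  0 < \sum_i u i -> 0 < \sum_i v i ->
  \sum_i u i `^ (1 - s) * v i `^ s <= (\sum_i u i) `^ (1 - s)
    * (\sum_i v i) `^ s.
Proof.
move=> s01 u0 v0; set U := \sum_i u i; set V := \sum_i v i => U0 V0.
have UV0 : 0 < U `^ (1 - s) * V `^ s by rewrite mulr_gt0 ?powR_gt0.
rewrite -[leRHS]mul1r -ler_pdivrMr // mulr_suml.
apply: (@le_trans _ _ (\sum_i ((1 - s) * (u i / U) + s * (v i / V))));
  last first.
  rewrite big_split /= -!mulr_sumr -!mulr_suml -/U -/V !divff ?gt_eqF //.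
  by rewrite !mulr1 subrK.
apply: ler_sum => i _.
have uU : 0 <= u i / U by rewrite divr_ge0 // ltW.
have vV : 0 <= v i / V by rewrite divr_ge0 // ltW.
apply: le_trans (powR_young s01 uU vV).
by rewrite !powR_div // invfM mulrACA.
Qed.

Definition lpsum (p : R) n (a : 'rV[R]_n) := \sum_i `|a 0 i| `^ p.

Lemma lpsum_ge0 p n (a : 'rV[R]_n) : 0 <= lpsum p a.
Proof. by apply: sumr_ge0 => i _; exact: powR_ge0. Qed.

(** The gradient of Tr |A|^p at the matrix [A] with [spectral A P a]. *)
Definition lpgrad (p : R) n (P : 'M[R]_n) (a : 'rV[R]_n) : 'M[R]_n :=
  P^T *m diag_mx (\row_i (p * (Num.sg (a 0 i) * `|a 0 i| `^ (p - 1)))) *m P.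

Lemma orthogonal_row_sum n (O : 'M[R]_n) : O *m O^T = 1%:M ->
  forall i l, \sum_j O i j * O l j = (i == l)%:R.
Proof.
move=> OO i l; have /matrixP/(_ i l) := OO; rewrite !mxE => <-.
by apply: eq_bigr => j _; rewrite mxE.
Qed.

Lemma orthogonal_col_sum n (O : 'M[R]_n) : O *m O^T = 1%:M ->
  forall j l, \sum_i O i j * O i l = (j == l)%:R.
Proof.
move=> /mulmx1C OO j l; have /matrixP/(_ j l) := OO; rewrite !mxE => <-.
by apply: eq_bigr => i _; rewrite mxE.
Qed.

Lemma orthogonal_mul n (P Q : 'M[R]_n) : P *m P^T = 1%:M -> Q *m Q^T = 1%:M ->
  (P *m Q^T) *m (P *m Q^T)^T = 1%:M.
Proof.
move=> PP /mulmx1C QQ.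
by rewrite trmx_mul trmxK mulmxA -(mulmxA P) QQ mulmx1.
Qed.

Lemma trace_spectral n (P Q : 'M[R]_n) (a b : 'rV[R]_n) :
  \tr ((P^T *m diag_mx a *m P) *m (Q^T *m diag_mx b *m Q)) =
  \sum_i \sum_j ((P *m Q^T) i j) ^+ 2 * (a 0 i * b 0 j).
Proof.
have -> : (P^T *m diag_mx a *m P) *m (Q^T *m diag_mx b *m Q) =
  P^T *m (diag_mx a *m (P *m Q^T) *m diag_mx b *m Q) by rewrite !mulmxA.
rewrite mxtrace_mulC.
have -> : diag_mx a *m (P *m Q^T) *m diag_mx b *m Q *m P^T =
  (diag_mx a *m (P *m Q^T) *m diag_mx b) *m (P *m Q^T)^T.
  by rewrite trmx_mul trmxK !mulmxA.
apply: eq_bigr => i _; rewrite mxE; apply: eq_bigr => j _.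
rewrite mul_mx_diag mul_diag_mx [X in X * _]mxE [X in X * _ * _]mxE [X in _
  * X]mxE.
by rewrite expr2; ring.
Qed.

Section bound.
Variables (p r : R) (n : nat) (A B P Q E : 'M[R]_n) (a b y : 'rV[R]_n).
Hypotheses (hp : 1 < p <= 2) (r_gt0 : 0 < r).
Hypotheses (spA : spectral A P a) (spB : spectral B Q b) (spY : spectral (B -
  A) E y).
Let eta := (2 - p) / p.

(** The squared inner products of the two eigenbases form a doubly stochastic matrix, so each single
    sum can be spread over all pairs. *)
Lemma lp_bregmanE : lpsum p b - lpsum p a - \tr (lpgrad p P a *m (B - A)) =
  \sum_i \sum_j ((P *m Q^T) i j) ^+ 2 * (`|b 0 j| `^ p - `|a 0 i| `^ p
     - p * (Num.sg (a 0 i) * `|a 0 i| `^ (p - 1)) * (b 0 j - a 0 i)).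
Proof.
case: spA spB => PP -> [QQ ->].
have OO := orthogonal_mul PP QQ.
rewrite mulmxBr [\tr (_ - _)]linearB /= !trace_spectral PP.
have s1 : lpsum p b = \sum_i \sum_j ((P *m Q^T) i j) ^+ 2 * `|b 0 j| `^ p.
  rewrite exchange_big; apply: eq_bigr => j _; rewrite -mulr_suml.
  under eq_bigr => i _ do rewrite expr2.
  by rewrite orthogonal_col_sum // eqxx mul1r.
have s2 (f : 'I_n -> R) : \sum_i f i = \sum_i \sum_j ((P *m Q^T) i j) ^+ 2
  * f i.
  apply: eq_bigr => i _; rewrite -mulr_suml.
  under eq_bigr => j _ do rewrite expr2.
  by rewrite orthogonal_row_sum // eqxx mul1r.
have -> : \sum_i \sum_j (1%:M : 'M[R]_n) i j ^+ 2 *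
   ((\row_i0 (p * (Num.sg (a 0 i0) * `|a 0 i0| `^ (p - 1)))) 0 i * a 0 j) =
   \sum_i (p * (Num.sg (a 0 i) * `|a 0 i| `^ (p - 1))) * a 0 i.
  apply: eq_bigr => i _; rewrite (bigD1 i) //= big1 ?addr0 => [|j ji].
    by rewrite !mxE eqxx expr1n mul1r.
  by rewrite !mxE eq_sym (negbTE ji) expr0n mul0r.
rewrite s1 [lpsum p a](s2 (fun i => `|a 0 i| `^ p)) (s2 (fun i => _
  * a 0 i)) -!sumrB; apply: eq_bigr => i _.
rewrite -!sumrB; apply: eq_bigr => j _; rewrite !mxE; ring.
Qed.

Let p_gt0 : 0 < p. Proof. by case/andP: hp; lra. Qed.

Let eta01 : 0 <= eta <= 1.
Proof.
case/andP: hp => p1 p2; rewrite /eta divr_ge0 ?subr_ge0 // ?(ltW p_gt0) //.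
by rewrite ler_pdivrMr // mul1r; lra.
Qed.

Let G : 'M[R]_n := P *m (B - A) *m Q^T.
(** The entries, between the eigenbases of [A] and [B], of the projection onto the k-th eigenvector
    of [B - A]. In these terms [Gw] is the spectral decomposition of [B - A]. *)
Let w k (ij : 'I_n * 'I_n) := (P *m E^T) ij.1 k * (Q *m E^T) ij.2 k.

Let GE i j : G i j = (P *m Q^T) i j * (b 0 j - a 0 i).
Proof.
rewrite /G mulmxBr mulmxBl; case: spA spB => PP -> [QQ ->].
rewrite !mulmxA PP mul1mx -(mulmxA _ Q Q^T) QQ mulmx1 -(mulmxA (diag_mx a)).
by rewrite mul_mx_diag mul_diag_mx; move: (P *m Q^T) => O; rewrite !mxE; ring.
Qed.

Let Gw i j : G i j = \sum_k y 0 k * w k (i, j).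
Proof.
rewrite /G; case: spY => _ ->; have -> : P *m (E^T *m diag_mx y *m E) *m Q^T =
  (P *m E^T *m diag_mx y) *m (Q *m E^T)^T by rewrite trmx_mul trmxK !mulmxA.
rewrite mxE; apply: eq_bigr => k _;
  rewrite mul_mx_diag [X in X * _]mxE [X in _ * X]mxE /w /=.
by ring.
Qed.

Let PE : (P *m E^T) *m (P *m E^T)^T = 1%:M.
Proof. by case: spA spY => PP _ [EE _]; exact: orthogonal_mul. Qed.

Let QE : (Q *m E^T) *m (Q *m E^T)^T = 1%:M.
Proof. by case: spB spY => QQ _ [EE _]; exact: orthogonal_mul. Qed.

Let w_ortho k l : \sum_ij w k ij * w l ij = (k == l)%:R.
Proof.
rewrite (eq_bigr (fun ij : 'I_n * 'I_n => ((P *m E^T) ij.1 k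
  * (P *m E^T) ij.1 l) *
  ((Q *m E^T) ij.2 k * (Q *m E^T) ij.2 l))) => [|ij _];
    last by rewrite /w mulrACA.
rewrite -(pair_bigA _ (fun i j => ((P *m E^T) i k * (P *m E^T) i l) *
  ((Q *m E^T) j k * (Q *m E^T) j l))) /=.
under eq_bigr => i _ do rewrite -mulr_sumr orthogonal_col_sum //.
by rewrite -mulr_suml orthogonal_col_sum //; case: eqP; rewrite ?mulr1 ?mulr0.
Qed.

(** In the part weighted by [f] the sum over [j] is an orthonormality relation, and in the part
    weighted by [g] the sum over [i] is one. Both vanish off the diagonal, which is why the weights
    must be sums of this kind. *)
Let w_diag (f g : 'I_n -> R) k l :
  \sum_ij (f ij.1 + g ij.2) * (w k ij * w l ij) =
  (\sum_i f i * (P *m E^T) i k ^+ 2 + \sum_j g j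
    * (Q *m E^T) j k ^+ 2) *+ (k == l).
Proof.
set U := P *m E^T; set V := Q *m E^T.
transitivity (\sum_i \sum_j ((f i * (U i k * U i l)) * (V j k * V j l) +
    (U i k * U i l) * (g j * (V j k * V j l)))).
  by rewrite pair_bigA; apply: eq_bigr => ij _; rewrite /w -/U -/V; ring.
under eq_bigr => i _ do rewrite big_split /= -!mulr_sumr orthogonal_col_sum //.
rewrite big_split /= -!mulr_suml orthogonal_col_sum //.
have [->|_] := eqVneq k l; last by rewrite mulr0 mul0r addr0.
by rewrite mulr1 mul1r.
Qed.

(* Adding e > 0 to the weights x makes them positive, as operator_jensen
   requires. *)
Lemma lp_bregman_eps (e : R) : 0 < e -> lpsum p a <= r `^ p -> lpsum p b
  <= r `^ p ->
  p * (p - 1) / 2 * lpsum p y `^ (2 / p) <=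
  (lpsum p b - lpsum p a - \tr (lpgrad p P a *m (B - A))) * (r `^ p
    + e *+ n) `^ eta.
Proof.
move=> e0 ar br.
have [p1 p2] := andP hp; have /andP[eta0 eta1] := eta01.
pose f i := 2 / 3 * `|a 0 i| `^ p; pose g j := `|b 0 j| `^ p / 3 + e.
pose x (ij : 'I_n * 'I_n) := f ij.1 + g ij.2.
have xE i j : x (i, j) = mean_pow p (a 0 i) (b 0 j) + e.
  by rewrite /x /f /g /mean_pow /=; field.
have m0 i j : 0 <= mean_pow p (a 0 i) (b 0 j).
  by rewrite divr_ge0 // addr_ge0 ?mulr_ge0 ?powR_ge0.
have x0 ij : 0 < x ij by case: ij => i j; rewrite xE ltr_wpDl.
set D := lpsum p b - lpsum p a - _.
pose L := \sum_ij x ij `^ (- eta) * G ij.1 ij.2 ^+ 2.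
have L0 : 0 <= L by apply: sumr_ge0 => ij _;
  rewrite mulr_ge0 ?powR_ge0 ?sqr_ge0.
have k0 : 0 <= p * (p - 1) / 2 by rewrite divr_ge0 // mulr_ge0 ?subr_ge0
  ?(ltW p1) ?(ltW p_gt0).
have DL : p * (p - 1) / 2 * L <= D.
  rewrite /D lp_bregmanE pair_bigA mulr_sumr; apply: ler_sum => -[i j] _ /=.
  rewrite GE exprMn.
  have -> c1 c2 c3 c4 : c1 * (c2 * (c3 * c4)) = c3 * (c1 * c4 * c2) :> R
    by ring.
  rewrite ler_wpM2l ?sqr_ge0 //.
  apply: le_trans (bregman_powR hp _ _).
  (* A zero mean forces both eigenvalues to be 0. Otherwise the negative power is decreasing on
     positive numbers, and adding [e] lowers it. *)
  have [m_eq0|m_neq0] := eqVneq (mean_pow p (a 0 i) (b 0 j)) 0.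
    have ap := powR_ge0 `|a 0 i| p; have bp := powR_ge0 `|b 0 j| p.
    have /powR_eq0_eq0/normr0_eq0 -> : `|a 0 i| `^ p = 0.
      by move: m_eq0; rewrite /mean_pow; lra.
    have /powR_eq0_eq0/normr0_eq0 -> : `|b 0 j| `^ p = 0.
      by move: m_eq0; rewrite /mean_pow; lra.
    by rewrite subrr expr0n /= !(mul0r, mulr0).
  have {}m0 : 0 < mean_pow p (a 0 i) (b 0 j) by rewrite lt0r m_neq0 m0.
  rewrite ler_wpM2l ?(mulr_ge0 k0) ?sqr_ge0 // xE !powRN.
  rewrite lef_pV2 ?posrE ?powR_gt0 // ?addr_gt0 //.
  by rewrite ge0_ler_powR ?nnegrE ?addr_ge0 ?(ltW m0) ?(ltW e0) // lerDl ltW.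
have D0 : 0 <= D by apply: le_trans DL; rewrite mulr_ge0.
have [S_eq0|S_neq0] := eqVneq (lpsum p y) 0.
  rewrite S_eq0 powR0 ?mulr0 ?mulr_ge0 ?powR_ge0 // ?mulf_neq0 ?invr_eq0
    ?gt_eqF //.
have {}S0 : 0 < lpsum p y by rewrite lt0r S_neq0 lpsum_ge0.
set S := lpsum p y in S0 *.
(* The vector dual to [y]: [y k * z k] is [|y k| ^ p], and [z k ^ 2] is at most its power
   [1 - eta]. *)
pose z k := Num.sg (y 0 k) * `|y 0 k| `^ (p - 1).
pose d k := \sum_i f i * (P *m E^T) i k ^+ 2 + \sum_j g j * (Q *m E^T) j k ^+ 2.
have f_ge0 i : 0 <= f i by rewrite mulr_ge0 ?powR_ge0 ?divr_ge0.
have g_ge j : e <= g j by rewrite lerDr divr_ge0 ?powR_ge0.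
have g_ge0 j : 0 <= g j by apply: le_trans (g_ge j); exact: ltW.
have d_ge0 k : 0 <= d k.
  by rewrite addr_ge0 // sumr_ge0 // => i _; rewrite mulr_ge0 ?sqr_ge0.
have dsumE : \sum_k d k = \sum_i f i + \sum_j g j.
  have sumsq (h : 'I_n -> R) (O : 'M[R]_n) : O *m O^T = 1%:M ->
      \sum_k \sum_i h i * O i k ^+ 2 = \sum_i h i.
    move=> OO; rewrite exchange_big; apply: eq_bigr => i _; rewrite -mulr_sumr.
    under eq_bigr => k _ do rewrite expr2.
    by rewrite orthogonal_row_sum // eqxx mulr1.
  by rewrite big_split /= !sumsq.
(* The shares 2/3 and 1/3 of the two p-th power sums add up to 1, and [e] is counted once per
   index. *)
have dsum : \sum_k d k <= r `^ p + e *+ n.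
  rewrite dsumE -mulr_sumr big_split /= -mulr_suml sumr_const card_ord.
  move: ar br; rewrite /lpsum; lra.
have n0 : (0 < n)%N.
  rewrite lt0n; apply: contraTneq S0 => n0.
  rewrite -leNgt /S /lpsum big1 // => i; have := ltn_ord i.
  by rewrite {2}n0.
have dsum0 : 0 < \sum_k d k.
  rewrite dsumE ltr_wpDl ?sumr_ge0 //.
  apply: lt_le_trans (_ : \sum_(j < n) e <= _); last exact: ler_sum.
  by rewrite sumr_const card_ord pmulrn_lgt0.
have yz k : y 0 k * z k = `|y 0 k| `^ p.
  by rewrite mulrA (mulrC (y 0 k)) -normrEsg mulr_powRB1.
have SE : S = \sum_ij G ij.1 ij.2 * \sum_k z k * w k ij.
  transitivity (\sum_k \sum_l y 0 k * z l * \sum_ij w k ij * w l ij).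
    apply: eq_bigr => k _; rewrite (bigD1 k) //= w_ortho eqxx mulr1 -yz.
    rewrite big1 ?addr0 // => l lk.
    by rewrite w_ortho eq_sym (negbTE lk) mulr0.
  under eq_bigr => k _ do under eq_bigr => l _ do rewrite mulr_sumr.
  under eq_bigr => k _ do rewrite exchange_big /=.
  rewrite exchange_big; apply: eq_bigr => -[i j] _ /=;
    rewrite Gw big_distrlr /=.
  by apply: eq_bigr => k _; apply: eq_bigr => l _; rewrite mulrACA.
(* Cauchy-Schwarz with the weights [x ^ (- eta)] and [x ^ eta], then the operator Jensen inequality
   for the second factor, then Hoelder's inequality between [|y| ^ p] and [d]. *)
have SL : S ^+ 2 <= L * (S `^ (1 - eta) * (r `^ p + e *+ n) `^ eta).
  apply: le_trans (_ : L * \sum_ij x ij `^ eta * (\sum_k z k * w k ij) ^+ 2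
    <= _).
    have LE : L = \sum_ij (x ij `^ (- eta / 2) * G ij.1 ij.2) ^+ 2.
      by apply: eq_bigr => ij _; rewrite exprMn powR_half_sqr.
    have -> : \sum_ij x ij `^ eta * (\sum_k z k * w k ij) ^+ 2 =
        \sum_ij (x ij `^ (eta / 2) * (\sum_k z k * w k ij)) ^+ 2.
      by apply: eq_bigr => ij _; rewrite exprMn powR_half_sqr.
    rewrite SE LE; apply: le_trans (cauchy_schwarz_sum _ _).
    rewrite le_eqVlt; apply/orP; left; apply/eqP; congr (_ ^+ 2).
    apply: eq_bigr => ij _; rewrite mulrACA mulNr -powRD ?(gt_eqF (x0 ij))
      ?implybT //.
    by rewrite addNr powRr0 mul1r.
  rewrite ler_wpM2l //.
  apply: le_trans (operator_jensen x0 w_ortho (w_diag f g) z eta01) _.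
  apply: le_trans (_ : \sum_k (`|y 0 k| `^ p) `^ (1 - eta) * d k `^ eta <= _).
    apply: ler_sum => k _; rewrite ler_wpM2r ?powR_ge0 //.
    rewrite exprMn sqr_sg -powRrM -(powR_half_sqr _ (p * (1 - eta))).
    have -> : p * (1 - eta) / 2 = p - 1 by rewrite /eta; field; rewrite gt_eqF.
    by case: eqP => _; rewrite ?mul1r ?mul0r ?sqr_ge0.
  apply: le_trans (powR_hoelder eta01 _ d_ge0 S0 dsum0) _ => [k|];
    first exact: powR_ge0.
  rewrite ler_wpM2l ?powR_ge0 // ge0_ler_powR ?nnegrE ?(ltW dsum0) //.
  by apply: le_trans dsum; exact: ltW.
have SS : S `^ (2 / p) * S `^ (1 - eta) = S ^+ 2.
  rewrite -powRD ?(gt_eqF S0) ?implybT // -powR_mulrn ?(ltW S0) //.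
  by congr (_ `^ _); rewrite /eta; field; rewrite gt_eqF.
have SW : S `^ (2 / p) <= L * (r `^ p + e *+ n) `^ eta.
  by rewrite -(ler_pM2r (powR_gt0 (1 - eta) S0)) SS mulrAC -mulrA.
apply: le_trans (ler_wpM2l k0 SW) _.
by rewrite mulrA ler_wpM2r ?powR_ge0.
Qed.

(** The limit of [lp_bregman_eps] as [e] tends to 0. *)
Lemma lp_bregman_ge : lpsum p a <= r `^ p -> lpsum p b <= r `^ p ->
  p * (p - 1) / 2 * r `^ (p - 2) * lpsum p y `^ (2 / p) <=
  lpsum p b - lpsum p a - \tr (lpgrad p P a *m (B - A)).
Proof.
move=> ar br; set D := lpsum p b - _ - _.
have /andP[eta0 eta1] := eta01; have [p1 p2] := andP hp.
have k0 : 0 <= p * (p - 1) / 2 by rewrite divr_ge0 // mulr_ge0 ?subr_ge0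
  ?(ltW p1) ?(ltW p_gt0).
set c := p * (p - 1) / 2 * lpsum p y `^ (2 / p).
have c0 : 0 <= c by rewrite mulr_ge0 ?powR_ge0.
have rp0 : 0 < r `^ p by rewrite powR_gt0.
have D0 : 0 <= D.
  have := le_trans c0 (lp_bregman_eps ltr01 ar br).
  by rewrite pmulr_lge0 // powR_gt0 // ltr_wpDr // mulrn_wge0.
suff cD : c <= D * r `^ (2 - p).
  rewrite mulrAC -/c (_ : p - 2 = - (2 - p)); last by rewrite opprB.
  rewrite powRN.
  by rewrite ler_pdivrMr ?powR_gt0.
apply/ler_addgt0Pr => t t0.
(* By the tangent bound for the power [eta], the perturbation costs at most [K * e], which is at
   most [t] for [e = t / (K + 1)]. *)
pose K := D * r `^ (2 - p) * eta * n%:R / r `^ p.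
have K0 : 0 <= K by rewrite divr_ge0 ?powR_ge0
  // (mulr_ge0 (mulr_ge0 (mulr_ge0 D0 (powR_ge0 _ _)) eta0)).
have K10 : 0 < K + 1 by rewrite ltr_wpDl.
pose e := t / (K + 1); have e0 : 0 < e by rewrite divr_gt0.
apply: le_trans (lp_bregman_eps e0 ar br) _.
have -> : r `^ p + e *+ n = r `^ p * (1 + e *+ n / r `^ p).
  by rewrite mulrDr mulr1 mulrCA divff ?mulr1 ?gt_eqF.
have en0 : 0 <= e *+ n / r `^ p
  by rewrite divr_ge0 ?powR_ge0 // mulrn_wge0 // ltW.
rewrite powRM ?powR_ge0 ?addr_ge0 // -powRrM.
have -> : p * eta = 2 - p by rewrite /eta; field; rewrite gt_eqF.
rewrite mulrA; apply: le_trans (ler_wpM2l _ (powR_le_tangent eta01 _)) _.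
- by rewrite mulr_ge0 ?powR_ge0.
- by rewrite addr_ge0.
rewrite [1 + _ - 1]addrAC subrr add0r mulrDr mulr1 lerD2l.
have -> : D * r `^ (2 - p) * (eta * (e *+ n / r `^ p)) = K * e.
  by rewrite /K -mulr_natr; ring.
by rewrite /e mulrA ler_pdivrMr //; nra.
Qed.

End bound.

End trace_bregman.

(** * Symmetric dilation and singular values *)

Section dilation.
Variable R : realType.

(** The block matrix [M] is made triangular by a multiplication on the right and by one on the left.
    The two determinants express the same [\det M] through both characteristic polynomials. *)
Lemma char_poly_mulmx_comm m n (A : 'M[R]_(m, n)) (B : 'M[R]_(n, m)) :
  'X^n * char_poly (A *m B) = 'X^m * char_poly (B *m A).
Proof.
pose Ap := map_mx (@polyC R) A; pose Bp := map_mx (@polyC R) B.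
pose M := block_mx 'X%:M Ap Bp 1%:M.
have MU : M *m block_mx 1%:M 0 (- Bp) 1%:M =
    block_mx (char_poly_mx (A *m B)) Ap 0 1%:M.
  rewrite mulmx_block !(mulmx1, mulmx0, mul1mx, add0r) mulmxN subrr.
  by rewrite /char_poly_mx map_mxM.
have LM : block_mx 1%:M 0 (- Bp) 'X%:M *m M =
    block_mx 'X%:M Ap 0 (char_poly_mx (B *m A)).
  rewrite mulmx_block !(mulmx1, mul0mx, mul1mx, addr0) mulNmx -scalar_mxC addNr.
  by rewrite /char_poly_mx map_mxM mulNmx addrC.
have := congr1 determinant MU; have := congr1 determinant LM.
rewrite !det_mulmx !det_ublock !det_lblock !det1 !mul1r !mulr1 !det_scalar.
by rewrite /char_poly => <- <-.
Qed.

Lemma char_poly_block_diag m n (A : 'M[R]_m) (B : 'M[R]_n) :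
  char_poly (block_mx A 0 0 B) = char_poly A * char_poly B.
Proof. by rewrite /char_poly char_block_diag_mx det_ublock. Qed.

Lemma spectral_char_poly n (A P : 'M[R]_n) (a : 'rV[R]_n) :
  spectral A P a -> char_poly A = \prod_(x <- [seq a 0 i | i : 'I_n]) ('X -
    x%:P).
Proof.
case=> PP ->; pose Pp := map_mx (@polyC R) P.
have PPp : Pp^T *m Pp = 1%:M by rewrite matrix.map_trmx -map_mxM (mulmx1C PP)
  map_mx1.
have : char_poly_mx (P^T *m diag_mx a *m P)
  = Pp^T *m char_poly_mx (diag_mx a) *m Pp.
  rewrite /char_poly_mx mulmxBr mulmxBl scalar_mxC -['X%:M *m _ *m _]mulmxA PPp
    mulmx1.
  by rewrite !map_mxM matrix.map_trmx.
move/(congr1 determinant); rewrite !det_mulmx mulrAC -det_mulmx PPp det1 mul1r.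
rewrite -/(char_poly _) -/(char_poly _) => ->.
rewrite char_poly_trig ?diag_mx_is_trig // big_image /=.
by apply: eq_bigr => i _; rewrite mxE eqxx.
Qed.

Lemma count_flatten_nseq (T : eqType) (g : T -> nat) (s : seq T) (y : T) : uniq
  s ->
  count_mem y (flatten [seq nseq (g x) x | x <- s])
    = if y \in s then g y else 0%N.
Proof.
elim: s => //= x s IH /andP[xs us]; rewrite count_cat count_nseq /= in_cons.
rewrite IH // eq_sym; have [->|_] /= := eqVneq y x; last by rewrite mul0n.
by rewrite (negbTE xs) mul1n addn0.
Qed.

Lemma prod_nseq0_XsubC k : \prod_(x <- nseq k (0 : R)) ('X - x%:P) = 'X^k.
Proof. by elim: k => [|k IH]; rewrite ?big_nil //= big_cons IH subr0 exprS. Qed.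

Lemma perm_eigenvalues n (A : 'M[R]_n) (s : seq R) :
  char_poly A = \prod_(x <- s) ('X - x%:P) -> perm_eq (eigenvalues A) s.
Proof.
move=> As; apply/allP => y _ /=; apply/eqP; rewrite /eigenvalues.
have A0 : char_poly A != 0 by rewrite monic_neq0 ?char_poly_monic.
rewrite count_flatten_nseq ?uniq_roots // -roots_on_rootsR // in_itv /=.
have [_|/mupNroot <-] := ifPn; by rewrite As mu_prod_XsubC.
Qed.

(* The nonzero eigenvalues of the dilation are the nonzero singular values of X
   and their opposites. *)
Definition dil m n (X : 'M[R]_(m, n)) : 'M[R]_(m + n) := block_mx 0 X X^T 0.

Lemma spectral_sqr n (A P : 'M[R]_n) (a : 'rV[R]_n) :
  spectral A P a -> spectral (A *m A) P (\row_i (a 0 i) ^+ 2).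
Proof.
case=> PP AE; split=> //; rewrite AE.
have -> : P^T *m diag_mx a *m P *m (P^T *m diag_mx a *m P) =
  P^T *m (diag_mx a *m (P *m P^T) *m diag_mx a) *m P by rewrite !mulmxA.
rewrite PP mulmx1; congr (_ *m _ *m _).
by rewrite mulmx_diag; congr diag_mx; apply/rowP => i; rewrite !mxE expr2.
Qed.

Lemma gram_sym m n (X : 'M[R]_(m, n)) : (X^T *m X)^T = X^T *m X.
Proof. by rewrite trmx_mul trmxK. Qed.

Lemma dil_sqr m n (X : 'M[R]_(m, n)) :
  dil X *m dil X = block_mx (X *m X^T) 0 0 (X^T *m X).
Proof. by rewrite mulmx_block !(mul0mx, mulmx0, add0r, addr0). Qed.

(** The square of the dilation has diagonal blocks [X *m X^T] and [X^T *m X], whose characteristic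
    polynomials agree up to powers of the indeterminate. The padding zeros balance these powers. *)
Lemma dil_perm m n (X : 'M[R]_(m, n)) P a : spectral (dil X) P a ->
  perm_eq (nseq n 0 ++ [seq a 0 i ^+ 2 | i : 'I_(m + n)])
   (nseq m 0 ++ eigenvalues (X^T *m X) ++ eigenvalues (X^T *m X)).
Proof.
move=> /spectral_sqr/spectral_char_poly.
rewrite dil_sqr char_poly_block_diag => E.
have [Q [d spd]] := symmetric_spectral (gram_sym X).
have cd := spectral_char_poly spd; have pd := perm_eigenvalues cd.
apply: prod_XsubC_eq; rewrite !big_cat /= !prod_nseq0_XsubC !(perm_big _ pd) /=
  -cd.
transitivity ('X^n * (char_poly (X *m X^T) * char_poly (X^T *m X))).
  rewrite E; congr (_ * _); rewrite !big_image; apply: eq_bigr => i _.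
  by rewrite mxE.
by rewrite mulrA char_poly_mulmx_comm mulrA.
Qed.

Lemma eigenvalues_gram_size m n (X : 'M[R]_(m, n)) : size (eigenvalues (X^T *m
  X)) = n.
Proof.
have [Q [d spd]] := symmetric_spectral (gram_sym X).
by rewrite (perm_size (perm_eigenvalues (spectral_char_poly spd))) size_map
  size_enum_ord.
Qed.

(** Multiplicities of the root 0 are compared in [char_poly_mulmx_comm]. This is what makes the
    truncation to [minn m n] singular values lossless. *)
Lemma eigenvalues_gram_zeros m n (X : 'M[R]_(m, n)) :
  (n - m <= count_mem 0%R (eigenvalues (X^T *m X)))%N.
Proof.
have [Q [d spd]] := symmetric_spectral (gram_sym X).
have [Q' [e spe]] : exists P a, spectral (X *m X^T) P a.
  by apply: symmetric_spectral; rewrite trmx_mul trmxK.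
have := char_poly_mulmx_comm X X^T.
rewrite (spectral_char_poly spe) (spectral_char_poly spd) -!prod_nseq0_XsubC
  -!big_cat.
move=> /prod_XsubC_eq/permP/(_ (pred1 0));
  rewrite !count_cat !count_nseq /= !eqxx !mul1n.
rewrite (permP (perm_eigenvalues (spectral_char_poly spd))) => E.
by rewrite leq_subLR -E leq_addr.
Qed.

(** A positive entry at an index [i >= k] would make the first [i + 1] entries positive, leaving
    fewer than [size s - k] places for zeros. *)
Lemma sorted_sum_truncate (f : R -> R) (s : seq R) (k : nat) : f 0 = 0 ->
  sorted >=%R s -> all (fun x => 0 <= x) s -> (size s - k
    <= count_mem 0%R s)%N ->
  (k <= size s)%N -> \sum_(i < k) f s`_i = \sum_(x <- s) f x.
Proof.
move=> f0 ss s0 cs ks.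
have tail i : (k <= i)%N -> s`_i = 0.
  move=> ki; have [si|si] := ltnP i (size s); last by rewrite nth_default.
  apply/eqP; apply: contraT => i0.
  have {}i0 : 0 < s`_i by rewrite lt0r i0 (all_nthP 0 s0).
  suff : (count_mem 0%R s <= size s - i.+1)%N.
    by move/(leq_trans cs); rewrite leq_sub2lE // leqNgt ltnS ki.
  rewrite -{1}(cat_take_drop i.+1 s) count_cat -size_drop.
  rewrite (_ : count _ (take _ _) = 0%N) ?count_size //.
  apply/eqP; rewrite -leqn0 leqNgt -has_count; apply/hasP => -[x /(nthP 0)[j]].
  rewrite size_take_min leq_min => /andP[ji js].
  rewrite nth_take // => <- /=; apply/negP; rewrite gt_eqF //.
  apply: lt_le_trans i0 _; apply: (sorted_leq_nth _ _ 0 ss) => //;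
    last exact: ge_refl.
  by move=> a b c ab bc; exact: le_trans bc ab.
rewrite (big_nth 0) (big_cat_nat (leq0n k) ks) /= big_mkord [X in _
  + X]big_nat_cond.
by rewrite [X in _ + X]big1 ?addr0 // => i /andP[/andP[ki _] _]; rewrite tail.
Qed.

(** Up to zeros, which [f] ignores, the absolute eigenvalues of the dilation are the singular values
    taken twice. *)
Lemma dil_sum (f : R -> R) m n (X : 'M[R]_(m, n)) P a : f 0 = 0 ->
  spectral (dil X) P a ->
  \sum_i f `|a 0 i| = 2 * \sum_(i < minn m n) f `|singular_values X 0 i|.
Proof.
move=> f0 /dil_perm pm; set ev := eigenvalues _ in pm.
have ev0 x : x \in ev -> 0 <= x.
  move=> xev; have : x \in nseq n 0 ++ [seq a 0 i ^+ 2 | i : 'I_(m + n)].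
    by rewrite (perm_mem pm) !mem_cat xev /= orbT.
  rewrite mem_cat => /orP[/nseqP[-> //]|/mapP[i _ ->]]; exact: sqr_ge0.
pose g x := f (Num.sqrt x).
have g0 k : \sum_(x <- nseq k 0) g x = 0.
  by apply: big1_seq => x /andP[_ /nseqP[-> _]]; rewrite /g sqrtr0.
have -> : \sum_i f `|a 0 i| = 2 * \sum_(x <- ev) g x.
  have := perm_big _ pm (op := +%R) (x := 0) (P := xpredT) (F := g).
  rewrite !big_cat /= !g0 !add0r big_image /= => E.
  rewrite -[2]/(1 + 1) mulrDl !mul1r -E; apply: eq_bigr => i _.
  by rewrite /g sqrtr_sqr.
congr (_ * _); set s := sort >=%R [seq Num.sqrt x | x <- ev].
have ps : perm_eq s [seq Num.sqrt x | x <- ev] by rewrite perm_sort.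
have s0 : all (fun x => 0 <= x) s.
  by rewrite (perm_all _ ps); apply/allP => _ /mapP[x _ ->]; exact: sqrtr_ge0.
have -> : \sum_(x <- ev) g x = \sum_(x <- s) f x.
  by rewrite (perm_big _ ps) big_map.
have ss : size s = n by rewrite size_sort size_map eigenvalues_gram_size.
rewrite -(@sorted_sum_truncate f s (minn m n)) //.
- apply: eq_bigr => i _; rewrite mxE -/ev -/s ger0_norm //.
  have [si|si] := ltnP i (size s); first exact: (all_nthP 0 s0).
  by rewrite nth_default.
- by apply: sort_sorted => x y; exact: le_total.
- rewrite ss (permP ps) count_map; apply: leq_trans (_ : n - m <= _)%N.
    by case: (leqP m n) => // nm; rewrite subnn.
  apply: leq_trans (eigenvalues_gram_zeros X) _.
  by apply: sub_count => x /= /eqP ->; rewrite sqrtr0.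
- by rewrite ss geq_minr.
Qed.

End dilation.

(** * Strong convexity of balls *)

Section uniform_convexity.
Variables (R : realType) (p : R) (E : lmodType R) (N : E -> R).
Hypotheses (hp : 1 < p <= 2) (N_ge0 : forall X, 0 <= N X).
Hypotheses (N_eq0 : forall X, N X = 0 -> X = 0).
Hypotheses (NZ : forall c X, N (c *: X) = `|c| * N X).
Hypothesis N_uc : forall (X Y : E) (r g : R),
  0 < r -> N X <= r -> N Y <= r -> 0 <= g <= 1 ->
  N (g *: X + (1 - g) *: Y) <= r ->
  N (g *: X + (1 - g) *: Y) `^ p <= g * N X `^ p + (1 - g) * N Y `^ p -
    p * (p - 1) / 2 * r `^ (p - 2) * (g * (1 - g) * N (X - Y) ^+ 2).
Implicit Types (X Y Z : E) (r c g s : R).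

Let p_gt0 : 0 < p. Proof. by case/andP: hp; lra. Qed.

Let N_le X c : 0 <= c -> N X `^ p <= c `^ p -> N X <= c.
Proof.
move=> c0; apply: contraTT; rewrite -!ltNge => cN.
by rewrite gt0_ltr_powR ?nnegrE.
Qed.

(** The radius [s], the larger of [r] and [N W], makes the premise of [N_uc] on the mean hold by
    construction. The resulting bound by the average of [N X ^ p] and [N Y ^ p] brings the radius
    back to [r]. *)
Lemma uniform_convex_ball X Y r g : 0 < r -> N X <= r -> N Y <= r -> 0 <= g
  <= 1 ->
  N (g *: X + (1 - g) *: Y) <= r.
Proof.
move=> r0 Xr Yr g01; have /andP[g0 g1] := g01; set W := _ + _.
pose s := Num.max r (N W).
have rs : r <= s by rewrite le_max lexx.
have s0 : 0 < s by apply: lt_le_trans rs.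
have := N_uc s0 (le_trans Xr rs) (le_trans Yr rs) g01.
rewrite -/W le_max lexx orbT => /(_ isT) H.
apply: N_le; first exact: ltW.
apply: le_trans H _; have [p1 _] := andP hp.
have g1' : 0 <= 1 - g by rewrite subr_ge0.
have NX : N X `^ p <= r `^ p by rewrite ge0_ler_powR ?nnegrE ?(ltW p_gt0)
  ?N_ge0 ?(ltW r0).
have NY : N Y `^ p <= r `^ p by rewrite ge0_ler_powR ?nnegrE ?(ltW p_gt0)
  ?N_ge0 ?(ltW r0).
have HX := ler_wpM2l g0 NX; have HY := ler_wpM2l g1' NY.
apply: le_trans (_ : g * N X `^ p + (1 - g) * N Y `^ p <= _); last by lra.
have k0 : 0 <= p * (p - 1) / 2.
  by rewrite divr_ge0 // mulr_ge0 ?subr_ge0 ?(ltW p1) ?(ltW p_gt0).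
rewrite lerBlDr lerDl mulr_ge0 //; first by rewrite mulr_ge0 ?powR_ge0.
by rewrite mulr_ge0 ?sqr_ge0 // mulr_ge0.
Qed.

(** [X + Y] is a convex combination of the multiples of [X] and [Y] that have norm [N X + N Y], so
    convexity of that ball applies. *)
Lemma uniform_convexD X Y : N (X + Y) <= N X + N Y.
Proof.
have [X0|X0] := eqVneq (N X) 0; first by rewrite (N_eq0 X0) add0r lerDr N_ge0.
have [Y0|Y0] := eqVneq (N Y) 0; first by rewrite (N_eq0 Y0) addr0 lerDl N_ge0.
have {}X0 : 0 < N X by rewrite lt0r X0 N_ge0.
have {}Y0 : 0 < N Y by rewrite lt0r Y0 N_ge0.
set s := N X + N Y; have s0 : 0 < s by rewrite addr_gt0.
have := @uniform_convex_ball ((s / N X) *: X) ((s / N Y) *: Y) s (N X / s) s0.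
rewrite !NZ !ger0_norm ?divr_ge0 ?(ltW s0) ?(ltW X0) ?(ltW Y0) //.
rewrite !divfK ?gt_eqF // lexx ler_pdivrMr // mul1r lerDl (ltW Y0) !scalerA.
have -> : N X / s * (s / N X) = 1 by field; rewrite !gt_eqF.
have -> : (1 - N X / s) * (s / N Y) = 1.
  by rewrite /s in s0 *; field; rewrite !gt_eqF.
by rewrite !scale1r; apply.
Qed.

(** With [r * u] the allowed length of [s *: Z], [N_uc] gives [N W ^ p <= r ^ p (1 - p u)], and
    Bernoulli's inequality gives [N W <= r (1 - u)]. Bounding only [s * N Z] lets [Z] be normalised
    in another norm. *)
Lemma uniform_convex_strong X Y Z r g s : 0 < r -> N X <= r -> N Y <= r -> 0
  <= g <= 1 ->
  0 <= s -> s * N Z <= g * (1 - g) * ((p - 1) / r / 2) * N (X - Y) ^+ 2 ->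
  N (g *: X + (1 - g) *: Y + s *: Z) <= r.
Proof.
move=> r0 Xr Yr g01 s0 sZ; have [p1 p2] := andP hp; have /andP[g0 g1] := g01.
apply: le_trans (uniform_convexD _ _) _; rewrite NZ ger0_norm //.
have := N_uc r0 Xr Yr g01 (uniform_convex_ball r0 Xr Yr g01).
set W := _ + _ => HW.
pose u := g * (1 - g) * ((p - 1) / 2) * N (X - Y) ^+ 2 / r ^+ 2.
have u0 : 0 <= u.
  by rewrite !mulr_ge0 ?invr_ge0 ?sqr_ge0 ?subr_ge0 ?(ltW p1).
have ru : g * (1 - g) * ((p - 1) / r / 2) * N (X - Y) ^+ 2 = r * u.
  by rewrite /u; field; rewrite gt_eqF.
have rp0 : 0 < r `^ p by rewrite powR_gt0.
have Wu : N W `^ p <= r `^ p * (1 - p * u).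
  apply: le_trans HW _.
  have NX : N X `^ p <= r `^ p by rewrite ge0_ler_powR ?nnegrE ?(ltW p_gt0)
    ?N_ge0 ?(ltW r0).
  have NY : N Y `^ p <= r `^ p by rewrite ge0_ler_powR ?nnegrE ?(ltW p_gt0)
    ?N_ge0 ?(ltW r0).
  have g1' : 0 <= 1 - g by rewrite subr_ge0.
  have HX := ler_wpM2l g0 NX; have HY := ler_wpM2l g1' NY.
  have -> : r `^ p * (1 - p * u) = r `^ p -
     p * (p - 1) / 2 * r `^ (p - 2) * (g * (1 - g) * N (X - Y) ^+ 2).
    have -> : r `^ p = r `^ (p - 2) * r ^+ 2.
      by rewrite -powR_mulrn ?(ltW r0) // -powRD ?(gt_eqF r0) ?implybT // subrK.
    by rewrite /u; field; rewrite gt_eqF.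
  by rewrite lerD2r; lra.
have pu1 : p * u <= 1.
  by have := le_trans (powR_ge0 _ _) Wu; rewrite pmulr_rge0 // subr_ge0.
have u1 : 0 <= 1 - u by nra.
have NW : N W <= r * (1 - u).
  apply: N_le; first by rewrite mulr_ge0 ?(ltW r0).
  apply: le_trans Wu _; rewrite powRM ?(ltW r0) // ler_wpM2l ?(ltW rp0) //.
  by have := powR_ge_tangent (ltW p1) u1; lra.
by move: NW sZ; rewrite ru; lra.
Qed.

End uniform_convexity.

(** * Uniform convexity of the Schatten norm *)

Section schatten.
Variables (R : realType) (p : R) (m n : nat).
Hypothesis hp : 1 < p <= 2.
Implicit Types (X Y Z : 'M[R]_(m, n)) (r c g : R).
Local Notation N := (schatten_norm p).

Let p_gt0 : 0 < p. Proof. by case/andP: hp; lra. Qed.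
Let p_neq0 : p != 0. Proof. by rewrite gt_eqF. Qed.

Lemma dil_spectral X : exists P a, spectral (dil X) P a.
Proof. by apply: symmetric_spectral; rewrite tr_block_mx !trmx0 trmxK. Qed.

Lemma dilB X Y : dil (X - Y) = dil X - dil Y.
Proof. by rewrite /dil opp_block_mx add_block_mx !subr0 linearB. Qed.

Lemma dilZ c X : dil (c *: X) = c *: dil X.
Proof. by rewrite /dil scale_block_mx !scaler0 linearZ. Qed.

Lemma dil_inj0 X : dil X = 0 -> X = 0.
Proof. by rewrite /dil -[0 in RHS]block_mx0 => /eq_block_mx[]. Qed.

Lemma schatten_ge0 X : 0 <= N X.
Proof. exact: powR_ge0. Qed.

Lemma schatten_powR X : N X `^ p = \sum_i `|singular_values X 0 i| `^ p.
Proof.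
rewrite /schatten_norm /lp_norm -powRrM mulVf // powRr1 //.
by apply: sumr_ge0 => i _; exact: powR_ge0.
Qed.


Lemma lpsum_dil X P a : spectral (dil X) P a -> lpsum p a = 2 * N X `^ p.
Proof.
move=> spX; rewrite schatten_powR.
exact: (@dil_sum R (@powR R ^~ p) _ _ _ _ _ (powR0 p_neq0) spX).
Qed.

Lemma schatten_le X c : 0 <= c -> N X `^ p <= c `^ p -> N X <= c.
Proof.
move=> c0; apply: contraTT; rewrite -!ltNge => cN.
by rewrite gt0_ltr_powR ?nnegrE ?schatten_ge0.
Qed.

Lemma schattenZ c X : N (c *: X) = `|c| * N X.
Proof.
have [P [a spX]] := dil_spectral X.
have spcX : spectral (dil (c *: X)) P (c *: a).
  case: spX => PP XE; split=> //; rewrite dilZ XE linearZ /=.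
  by rewrite -scalemxAr -scalemxAl.
have E : N (c *: X) `^ p = (`|c| * N X) `^ p.
  have E2 : 2 * N (c *: X) `^ p = 2 * (`|c| * N X) `^ p.
    rewrite -(lpsum_dil spcX) powRM ?schatten_ge0 // mulrCA -(lpsum_dil spX).
    rewrite mulr_sumr; apply: eq_bigr => i _.
    by rewrite mxE normrM powRM.
  lra.
by apply: (powR_injective p_gt0) => //; rewrite nnegrE ?mulr_ge0 ?schatten_ge0.
Qed.

Lemma schatten_eq0 X : N X = 0 -> X = 0.
Proof.
move=> NX; have [P [a spX]] := dil_spectral X.
have := lpsum_dil spX; rewrite NX powR0 // mulr0 => /eqP.
rewrite psumr_eq0 => [/allP a0|i _]; last exact: powR_ge0.
apply: dil_inj0; case: spX => _ ->; rewrite (_ : a = 0); last first.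
  apply/rowP => i; rewrite mxE.
  have /eqP/powR_eq0_eq0/normr0_eq0 := a0 i (mem_index_enum i).
  done.
by rewrite linear0 mulmx0 mul0mx.
Qed.

(** [G] is half the gradient at the dilation of [Z]. It is chosen before [X], so that the linear
    terms of two points can cancel. *)
Lemma schatten_bregman Z : exists G : 'M[R]_(m + n), forall X r, 0 < r ->
  N Z <= r -> N X <= r ->
  p * (p - 1) / 2 * r `^ (p - 2) * N (X - Z) ^+ 2 <=
  N X `^ p - N Z `^ p - \tr (G *m (dil X - dil Z)).
Proof.
have [P [a spZ]] := dil_spectral Z.
exists (2^-1 *: lpgrad p P a) => X r r0 Zr Xr.
have [Q [b spX]] := dil_spectral X.
have [E [y spY]] := dil_spectral (X - Z).
have yE := lpsum_dil spY; rewrite dilB in spY.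
(* t is the factor by which the dilation multiplies the p-norm. *)
have [t t0 tp] : exists2 t : R, 0 < t & t `^ p = 2.
  by exists (2 `^ p^-1); rewrite ?powR_gt0 // -powRrM mulVf // powRr1.
have bound Y Q' b' : spectral (dil Y) Q' b' -> N Y <= r -> lpsum p b' <= (t
  * r) `^ p.
  move=> /lpsum_dil -> Yr; rewrite powRM ?(ltW t0) ?(ltW r0) // tp ler_pM2l //.
  by rewrite ge0_ler_powR ?nnegrE ?(ltW p_gt0) ?schatten_ge0 ?(ltW r0).
have yN : lpsum p y `^ (2 / p) = t ^+ 2 * N (X - Z) ^+ 2.
  rewrite yE -{1}tp -powRM ?(ltW t0) ?schatten_ge0 // -powRrM mulrCA mulfV
    // mulr1.
  by rewrite powR_mulrn ?mulr_ge0 ?(ltW t0) ?schatten_ge0 // exprMn.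
(* The dilation thus multiplies both sides of the bound by the same factor 2. *)
have tt : t `^ (p - 2) * t ^+ 2 = 2.
  by rewrite -powR_mulrn ?(ltW t0) // -powRD ?(gt_eqF t0) ?implybT // subrK tp.
have := lp_bregman_ge hp (mulr_gt0 t0 r0) spZ spX spY (bound _ _ _ spZ Zr)
  (bound _ _ _ spX Xr).
rewrite (lpsum_dil spZ) (lpsum_dil spX) yN powRM ?(ltW t0) ?(ltW r0) //.
rewrite -scalemxAl mxtraceZ; move: (\tr _) => T.
have -> : p * (p - 1) / 2 * (t `^ (p - 2) * r `^ (p - 2)) * (t ^+ 2
  * N (X - Z) ^+ 2) =
  2 * (p * (p - 1) / 2 * r `^ (p - 2) * N (X - Z) ^+ 2).
  by rewrite -[X in _ = X * _]tt; ring.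
move=> H; rewrite -(ler_pM2l (ltr0Sn R 1)).
by apply: le_trans H _; rewrite !mulrBr mulVKf ?pnatr_eq0.
Qed.

(** The divergence bounds from [W] to [X] and to [Y] are averaged. The differences from [W] are
    [1 - g] and [- g] times [X - Y], so the linear terms cancel and the squares have total weight
    [g (1 - g)]. *)
Lemma schatten_uniform_convex X Y r g : 0 < r -> N X <= r -> N Y <= r -> 0
  <= g <= 1 ->
  N (g *: X + (1 - g) *: Y) <= r ->
  N (g *: X + (1 - g) *: Y) `^ p <= g * N X `^ p + (1 - g) * N Y `^ p -
    p * (p - 1) / 2 * r `^ (p - 2) * (g * (1 - g) * N (X - Y) ^+ 2).
Proof.
have aux (k v x y w T : R) : g * (k * ((1 - g) * v) ^+ 2) + (1 - g) * (k * (g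
  * v) ^+ 2) <=
    g * (x - w - (1 - g) * T) + (1 - g) * (y - w - - g * T) ->
    w <= g * x + (1 - g) * y - k * (g * (1 - g) * v ^+ 2) by lra.
move=> r0 Xr Yr /andP[g0 g1]; set W := g *: X + (1 - g) *: Y => Wr.
have [G HG] := schatten_bregman W.
have XW : X - W = (1 - g) *: (X - Y) by apply/matrixP => i j; rewrite !mxE;
  ring.
have YW : Y - W = - g *: (X - Y) by apply/matrixP => i j; rewrite !mxE; ring.
have g1' : 0 <= 1 - g by rewrite subr_ge0.
have := lerD (ler_wpM2l g0 (HG X r r0 Wr Xr)) (ler_wpM2l g1' (HG Y r r0 Wr Yr)).
rewrite -!dilB XW YW !schattenZ !dilZ -!scalemxAr !mxtraceZ normrN !ger0_norm
  //.
exact: aux.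
Qed.

End schatten.

(** * Comparison with the Frobenius norm *)

Section frobenius.
Variables (R : realType) (p : R) (m n : nat).
Hypothesis hp : 1 < p <= 2.
Implicit Types (X Y Z : 'M[R]_(m, n)) (r c g : R).
Local Notation N := (schatten_norm p).

Let p_gt0 : 0 < p. Proof. by case/andP: hp; lra. Qed.

(** Both sides are half the trace of the squared dilation. *)
Lemma frobenius_sqr X :
  frobenius_norm X ^+ 2 = \sum_i `|singular_values X 0 i| ^+ 2.
Proof.
rewrite sqr_sqrtr; last by do 2![apply: sumr_ge0 => ? _]; exact: sqr_ge0.
have [P [a spX]] := dil_spectral X.
have f0 : (0 : R) ^+ 2 = 0 by rewrite expr0n.
have := @dil_sum R (fun x => x ^+ 2) _ _ _ _ _ f0 spX.
have -> : \sum_i `|a 0 i| ^+ 2 = \tr (dil X *m dil X).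
  case: (spectral_sqr spX) => PP ->.
  rewrite mxtrace_mulC mulmxA PP mul1mx mxtrace_diag.
  by apply: eq_bigr => i _; rewrite mxE real_normK ?num_real.
rewrite dil_sqr mxtrace_block (mxtrace_mulC X^T).
have -> : \tr (X *m X^T) = \sum_i \sum_j X i j ^+ 2.
  by apply: eq_bigr => i _; rewrite mxE; apply: eq_bigr => j _;
    rewrite mxE expr2.
lra.
Qed.

(** No singular value exceeds the p-norm, so each square is at most its p-th power times
    [N X ^ (2 - p)]. *)
Lemma frobenius_le_schatten X : frobenius_norm X <= N X.
Proof.
have [p1 p2] := andP hp.
have N0 := schatten_ge0 p X.
have term i : `|singular_values X 0 i| <= N X.
  rewrite leNgt; apply/negP => lt.
  have := gt0_ltr_powR p_gt0 _ _ lt;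
    rewrite !nnegrE N0 normr_ge0 => /(_ isT isT).
  rewrite schatten_powR // (bigD1 i) //= ltNge lerDl sumr_ge0 // => j _;
    exact: powR_ge0.
rewrite -(ler_pXn2r (_ : 0 < 2)%N) ?nnegrE ?sqrtr_ge0 // frobenius_sqr.
have pw x : 0 <= x -> x `^ p * x `^ (2 - p) = x ^+ 2.
  have pE : p + (2 - p) = 2 by ring.
  by move=> x0; rewrite -powRD pE ?powR_mulrn // pnatr_eq0.
rewrite -[leRHS]pw // schatten_powR // mulr_suml ler_sum // => i _.
by rewrite -[leLHS]pw // ler_wpM2l ?powR_ge0 // ge0_ler_powR ?nnegrE ?subr_ge0.
Qed.

(** Hoelder's inequality between the constant 1 and the squared singular values, with exponents
    [1 - p / 2] and [p / 2]. *)
Lemma schatten_le_frobenius Z : (0 < minn m n)%N -> frobenius_norm Z = 1 ->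
  N Z <= (minn m n)%:R `^ (p^-1 - 2^-1).
Proof.
move=> k0 Z1; have [p1 p2] := andP hp.
have k0' : 0 < (minn m n)%:R :> R by rewrite ltr0n.
have Zs : \sum_i `|singular_values Z 0 i| ^+ 2 = 1
  by rewrite -frobenius_sqr Z1 expr1n.
apply: (schatten_le hp); first exact: powR_ge0.
rewrite schatten_powR // -powRrM.
have p20 : 0 <= p / 2 <= 1 by apply/andP; split; lra.
have ones : \sum_(i < minn m n) 1 = (minn m n)%:R :> R
  by rewrite sumr_const card_ord.
have := @powR_hoelder R _ (p / 2) (fun=> 1) (fun i
  => `|singular_values Z 0 i| ^+ 2) p20.
rewrite Zs ones powR1 mulr1 => /(_ (fun=> ler01) (fun=> sqr_ge0 _) k0' ltr01).
have -> : (p^-1 - 2^-1) * p = 1 - p / 2 by field; rewrite gt_eqF.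
apply: le_trans; rewrite le_eqVlt; apply/orP; left; apply/eqP.
apply: eq_bigr => i _ /=; rewrite mul1r -powR_mulrn // -powRrM.
by congr (_ `^ _); field.
Qed.

End frobenius.

Theorem corollary2 (R : realType) (p r : R) (m n : nat)
    (hp : 1 < p <= 2) (hr : 0 < r) (hm : (0 < m)%N) (hn : (0 < n)%N) :
  strongly_convex (@schatten_norm R p m n) ((p - 1) / r)
    (@schatten_ball R p m n r) /\
  strongly_convex (@frobenius_norm R m n)
    ((p - 1) * (minn m n)%:R `^ (2^-1 - p^-1) / r)
    (@schatten_ball R p m n r).
Proof.
have [p1 p2] := andP hp.
have uc := @schatten_uniform_convex R p m n hp.
have strong := @uniform_convex_strong R p _ _ hp (@schatten_ge0 R p m n)
  (@schatten_eq0 R p m n hp) (@schattenZ R p m n hp) uc.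
have convexK : convex_set (@schatten_ball R p m n r).
  move=> X Y l /set_mem Xr /set_mem Yr; apply/mem_set.
  apply: (uniform_convex_ball hp (@schatten_ge0 R p m n) uc hr Xr Yr).
  by rewrite ge0 le1.
have g0 g : 0 <= g <= 1 -> 0 <= g * (1 - g) by case/andP => ? ?;
  rewrite mulr_ge0 ?subr_ge0.
have a0 : 0 <= (p - 1) / r / 2 by rewrite !divr_ge0 ?subr_ge0 ?(ltW p1)
  ?(ltW hr).
have K0 (k : R) g : 0 <= k -> 0 <= g <= 1 -> 0 <= g * (1 - g) * k.
  by move=> k0 /andP[? ?]; rewrite mulr_ge0 // mulr_ge0 ?subr_ge0.
split; (split; first exact: convexK) => X Y g Z Xr Yr g01 Z1.
  apply: (strong _ _ _ _ _ _ hr Xr Yr g01).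
    by rewrite mulr_ge0 ?sqr_ge0 // K0.
  by rewrite Z1 mulr1.
have k0 : (0 < minn m n)%N by rewrite leq_min hm hn.
have NZ := schatten_le_frobenius hp k0 Z1.
have FN : frobenius_norm (X - Y) ^+ 2 <= schatten_norm p (X - Y) ^+ 2.
  by rewrite ler_pXn2r ?nnegrE ?sqrtr_ge0 ?schatten_ge0 ?frobenius_le_schatten.
pose k : R := (minn m n)%:R; have k_gt0 : 0 < k by rewrite ltr0n.
(* The power of [k] in the modulus exactly offsets the largest p-norm of a [Z] of Frobenius norm
   1. *)
have kE : k `^ (2^-1 - p^-1) * k `^ (p^-1 - 2^-1) = 1.
  by rewrite -powRD ?(gt_eqF k_gt0) ?implybT // addrA subrK subrr powRr0.
have q0 : 0 <= k `^ (2^-1 - p^-1) by exact: powR_ge0.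
apply: (strong _ _ _ _ _ _ hr Xr Yr g01).
  rewrite mulr_ge0 ?sqr_ge0 // K0 //.
  by rewrite divr_ge0 // divr_ge0 ?(ltW hr) // mulr_ge0 ?subr_ge0 ?(ltW p1).
have c0 := K0 _ _ a0 g01.
apply: le_trans (ler_wpM2l c0 FN).
have -> : g * (1 - g) * ((p - 1) * k `^ (2^-1 - p^-1) / r / 2) = 
  g * (1 - g) * ((p - 1) / r / 2) * k `^ (2^-1 - p^-1) by ring.
rewrite -mulrA -mulrA ler_wpM2l // (mulrCA _ (_ ^+ 2)) ler_piMr ?sqr_ge0 //.
by apply: le_trans (ler_wpM2l q0 NZ) _; rewrite kE.
Qed.
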